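(* Let $H:[0,T]\times\mathbb{R}^n\times\mathbb{R}^n\to\mathbb{R}$ be such that $H(\cdot,x,p)$ is measurable for all $(x,p)\in\mathbb{R}^n\times\mathbb{R}^n$, $H(t,\cdot,\cdot)$ is continuous for every $t\in[0,T]$, and $H(t,x,\cdot)$ is convex for every $(t,x)\in[0,T]\times\mathbb{R}^n$. Suppose moreover that for every $R>0$ there are a measurable $k_R:[0,T]\to[0,\infty)$, a modulus $w_R$ and a null set $\mathcal{N}_R\subset[0,T]$ such that $$|H(t,x,p)-H(t,y,p)|\le k_R(t)\,|p|\,|x-y|+w_R(t,|x-y|)\quad\text{for all } t\in[0,T]\setminus\mathcal{N}_R,\ x,y\in B_R,\ p\in\mathbb{R}^n .$$ Then, with $A:=\mathbb{R}^{n+1}$, there exist $f:[0,T]\times\mathbb{R}^n\times A\to\mathbb{R}^n$ and $l:[0,T]\times\mathbb{R}^n\times A\to\mathbb{R}$, measurable in $t$ for all $(x,a)\in\mathbb{R}^n\times A$ and continuous in $(x,a)$ for all $t\in[0,T]$, such that for all $t\in[0,T]$, $x,p\in\mathbb{R}^n$ $$H(t,x,p)=\sup_{a\in\mathbb{R}^{n+1}}\{\langle p,f(t,x,a)\rangle-l(t,x,a)\}$$ and $f(t,x,A)=\mathrm{dom}\,H^{*}(t,x,\cdot)$. Moreover: (i) $l(t,x,a)\ge-|H(t,x,0)|$ for all $t\in[0,T]$, $x\in\mathbb{R}^n$, $a\in\mathbb{R}^{n+1}$. (ii) For all $R>0$, $t\in[0,T]\setminus\mathcal{N}_R$, $x,y\in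 B_R$, $a,b\in\mathbb{R}^{n+1}$, $$|f(t,x,a)-f(t,y,b)|\le 10(n+1)\,[\,k_R(t)|x-y|+w_R(t,|x-y|)+|a-b|\,],$$ $$|l(t,x,a)-l(t,y,b)|\le 10(n+1)\,[\,k_R(t)|x-y|+w_R(t,|x-y|)+|a-b|\,].$$ (iii) If in addition there is a measurable $c:[0,T]\to[0,\infty)$ with $|H(t,x,p)-H(t,x,q)|\le c(t)(1+|x|)|p-q|$ for all $(t,x)\in[0,T]\times\mathbb{R}^n$ and $p,q\in\mathbb{R}^n$, then $|f(t,x,a)|\le c(t)(1+|x|)$ for all $t\in[0,T]$, $x\in\mathbb{R}^n$, $a\in\mathbb{R}^{n+1}$. (iv) If $H$ is continuous (jointly in $(t,x,p)$), then $f,l$ are continuous (jointly in $(t,x,a)$).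
   Context: $|\cdot|$ is the Euclidean norm, $\langle\cdot,\cdot\rangle$ the scalar product, and $B_R$ is the closed ball in $\mathbb{R}^n$ centered at $0$ with radius $R$. Measurable means Lebesgue measurable and a null set is a set of Lebesgue measure zero. A modulus is a function $w:[0,T]\times[0,\infty)\to[0,\infty)$ such that $w(\cdot,r)$ is measurable for every $r\ge0$ and, for every $t\in[0,T]$, $w(t,\cdot)$ is nondecreasing, continuous, subadditive and $w(t,0)=0$. $H^{*}(t,x,v):=\sup_{p\in\mathbb{R}^n}\{\langle v,p\rangle-H(t,x,p)\}$ is the Legendre–Fenchel transform of $H$ in the last variable (possibly $+\infty$), and $\mathrm{dom}\,\varphi:=\{x:\varphi(x)\ne\pm\infty\}$. *)

(* Defs.v *)
From HB Require Import structures.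
From mathcomp Require Import all_boot all_order all_algebra.
From mathcomp Require Import all_classical all_reals all_analysis.

Set Implicit Arguments.
Unset Strict Implicit.
Unset Printing Implicit Defensive.

Import Order.TTheory GRing.Theory Num.Theory.
Import numFieldNormedType.Exports.

Local Open Scope classical_set_scope.
Local Open Scope ring_scope.

Definition dot (R : realType) (n : nat) (u v : 'rV[R]_n) : R :=
  \sum_(i < n) u 0 i * v 0 i.

(* The library norm on 'rV[R]_n is the sup norm (with the same topology). *)
Definition enorm (R : realType) (n : nat) (u : 'rV[R]_n) : R :=
  Num.sqrt (dot u u).

Definition cball (R : realType) (n : nat) (r : R) : set 'rV[R]_n :=
  [set x | enorm x <= r].

(* The canonical measurable sets of R are the Borel sets; the Caratheodory
   sigma-algebra of the length is the Lebesgue sigma-algebra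
   (completed_caratheodory_measurable). *)
Definition lebesgue_measurable_fun (R : realType) (d : measure_display)
    (U : measurableType d) (D : set R) (g : R -> U) : Prop :=
  @measurable_fun _ _ (caratheodory_type ((@wlength R idfun)^*)%mu) U D g.

Definition borel_rV (R : realType) (n : nat) :=
  g_sigma_algebraType (@open 'rV[R]_n).

(* Functions of t in [0, T] and r >= 0 are represented by total functions on
   R, about which nothing is assumed or asserted off the stated domain. *)
Definition is_modulus (R : realType) (T : R) (w : R -> R -> R) : Prop :=
  (forall r, 0 <= r -> lebesgue_measurable_fun `[0, T] (w^~ r)) /\
  (forall t, t \in `[0, T] ->
    [/\ forall r, 0 <= r -> 0 <= w t r,
        forall r s, 0 <= r -> r <= s -> w t r <= w t s,
        {within `[0, +oo[, continuous (w t)},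
        forall r s, 0 <= r -> 0 <= s -> w t (r + s) <= w t r + w t s
      & w t 0 = 0]).

(* fconj h v = sup_p (<v, p> - h p), a value in [-oo, +oo] *)
Definition fconj (R : realType) (n : nat) (h : 'rV[R]_n -> R)
    (v : 'rV[R]_n) : \bar R :=
  ereal_sup (range (fun p : 'rV[R]_n => (dot v p - h p)%:E)).

Definition edom (R : realType) (U : Type) (phi : U -> \bar R) : set U :=
  [set u | phi u \is a fin_num].

(* Main.v *)
Require Import Defs.
From HB Require Import structures.
From mathcomp Require Import all_boot all_order all_algebra.
From mathcomp Require Import all_classical all_reals all_analysis.
From mathcomp Require Import perm ring lra.

Set Implicit Arguments.
Unset Strict Implicit.
Unset Printing Implicit Defensive.

Import Order.TTheory GRing.Theory Num.Theory.
Import numFieldNormedType.Exports.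

Local Open Scope classical_set_scope.
Local Open Scope ring_scope.

(** The epigraph [K] of the conjugate of [h := H t x] is a closed convex set in
    dimension [n + 1] (its points are pairs of a height and a slope), and by
    Fenchel-Moreau [h p] is the supremum of [dot p v - eta] over the points
    [(eta, v)] of [K].  So it suffices to parametrize [K] by a map [e] from
    the whole space onto [K] that depends well on [h], and to let [f] be the
    slope and [l] the height of [e].

    The map is [e a = s (K_a)], where [K_a] is the set of points of [K] whose
    distance to [a] is at most twice that of the nearest point, and [s] selects a
    point of every compact convex set.  It is onto because [K_a] is [{a}] when
    [a] is in [K].  The truncation is 10-Lipschitz in [(a, K)] for the Hausdorff
    distance ([nearby_lipschitz]), and [s] is Lipschitz with constant the
    dimension ([steiner_lipschitz]), whence the factor [10 (n + 1)].

    The selection [s] is a discrete variant of the Steiner point.  The mean over a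
    cube of the gradient of the support function of [P] belongs to [P], because
    the gradients do; integrating each partial derivative first in its own
    direction shows that the mean only involves values of the support function on
    the faces, so it is Lipschitz in [P].  Integrals are replaced by sums over
    finer and finer grids ([steiner_approx]), which belong to [P] up to an error
    of the order of the step ([steiner_approx_near]), and the limit is taken along
    a free ultrafilter, which preserves both properties without any proof of
    convergence.

    The estimate in [x] comes from [conj_epi_near]: an inequality between two
    convex functions, up to [A |p| + B], puts every point of one conjugate
    epigraph within [A + B] of the other one.

    All the regularity in [t] comes from a single stability statement
    ([selection_cvg]): along any filter, if convex functions converge at the
    rational points and the parameters [a] converge, then so do the selected
    points.  It applies to neighborhoods of [(x, a)] and of [(t, x, a)].  Since it
    involves countably many numbers [H t x q] only, it also gives measurability:
    the inverse image of an open set is a countable union of sets cut out by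
    finitely many inequalities on these numbers
    ([measurable_preimage_open]). *)

(** * Euclidean geometry of row vectors *)

Section Euclidean.
Context (R : realType) (m : nat).
Implicit Types (u v w x y z : 'rV[R]_m) (s : R).

Lemma dotC u v : dot u v = dot v u.
Proof. by apply: eq_bigr => i _; rewrite mulrC. Qed.

Lemma dotDl u v w : dot (u + v) w = dot u w + dot v w.
Proof.
by rewrite /dot -big_split; apply: eq_bigr => i _; rewrite mxE mulrDl.
Qed.

Lemma dotZl s u v : dot (s *: u) v = s * dot u v.
Proof.
by rewrite /dot mulr_sumr; apply: eq_bigr => i _; rewrite mxE mulrA.
Qed.

Lemma dotNl u v : dot (- u) v = - dot u v.
Proof. by rewrite -scaleN1r dotZl mulN1r. Qed.

Lemma dotBl u v w : dot (u - v) w = dot u w - dot v w.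
Proof. by rewrite dotDl dotNl. Qed.

Lemma dotDr u v w : dot u (v + w) = dot u v + dot u w.
Proof. by rewrite dotC dotDl !(dotC u). Qed.

Lemma dotZr s u v : dot u (s *: v) = s * dot u v.
Proof. by rewrite dotC dotZl (dotC u). Qed.

Lemma dotNr u v : dot u (- v) = - dot u v.
Proof. by rewrite dotC dotNl (dotC u). Qed.

Lemma dotBr u v w : dot u (v - w) = dot u v - dot u w.
Proof. by rewrite dotDr dotNr. Qed.

Lemma dot0l u : dot 0 u = 0.
Proof. by rewrite -(scale0r 0) dotZl mul0r. Qed.

Lemma dot0r u : dot u 0 = 0.
Proof. by rewrite dotC dot0l. Qed.

Definition dotE := (dotDl, dotDr, dotNl, dotNr, dotZl, dotZr).

Lemma dot_ge0 u : 0 <= dot u u.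
Proof. by apply: sumr_ge0 => i _; rewrite -expr2 sqr_ge0. Qed.

Lemma enorm_ge0 u : 0 <= enorm u.
Proof. exact: sqrtr_ge0. Qed.

Lemma enorm_sqr u : enorm u ^+ 2 = dot u u.
Proof. by rewrite sqr_sqrtr// dot_ge0. Qed.

Lemma enormZ s u : enorm (s *: u) = `|s| * enorm u.
Proof.
rewrite /enorm dotZl dotZr mulrA -expr2 sqrtrM ?sqr_ge0//.
by rewrite sqrtr_sqr.
Qed.

Lemma enormN u : enorm (- u) = enorm u.
Proof. by rewrite -scaleN1r enormZ normrN1 mul1r. Qed.

Lemma enormB u v : enorm (u - v) = enorm (v - u).
Proof. by rewrite -enormN opprB. Qed.

Lemma enorm0 : enorm (0 : 'rV[R]_m) = 0.
Proof. by rewrite /enorm dot0l sqrtr0. Qed.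

Lemma coord_enorm u i : `|u 0 i| <= enorm u.
Proof.
rewrite -(@ler_pXn2r _ 2)// ?nnegrE ?enorm_ge0// enorm_sqr.
rewrite real_normK ?num_real// /dot (bigD1 i)//= -expr2 lerDl.
by apply: sumr_ge0 => j _; rewrite -expr2 sqr_ge0.
Qed.

Lemma enorm0_eq0 u : enorm u = 0 -> u = 0.
Proof.
move=> u0; apply/rowP => i; rewrite mxE; apply/eqP.
by rewrite -normr_le0 -u0 coord_enorm.
Qed.

Lemma cauchy_schwarz u v : dot u v <= enorm u * enorm v.
Proof.
have := enorm_ge0 u; rewrite le_eqVlt => /orP[/eqP/esym u0|u_gt0].
  by rewrite u0 mul0r (enorm0_eq0 u0) dot0l.
have := dot_ge0 (enorm u ^+ 2 *: v - dot u v *: u).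
rewrite !dotE -!enorm_sqr (dotC v u) => h.
have {}h : dot u v ^+ 2 <= (enorm u * enorm v) ^+ 2.
  rewrite -(@ler_pM2l _ (enorm u ^+ 2)) ?exprn_gt0// exprMn.
  by move: h; lra.
have uv0 : 0 <= enorm u * enorm v by rewrite mulr_ge0// enorm_ge0.
rewrite (le_trans (ler_norm _))// -(@ler_pXn2r _ 2)// ?nnegrE//.
by rewrite real_normK ?num_real.
Qed.

Lemma enormD u v : enorm (u + v) <= enorm u + enorm v.
Proof.
rewrite -(@ler_pXn2r _ 2)// ?nnegrE ?addr_ge0 ?enorm_ge0//.
rewrite enorm_sqr !dotE (dotC v u) sqrrD !enorm_sqr.
have := cauchy_schwarz u v; lra.
Qed.

Lemma enorm_triangle z x y : enorm (x - y) <= enorm (x - z) + enorm (z - y).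
Proof. by rewrite -(subrKA z x (- y)) enormD. Qed.

Lemma enorm_leB u v : enorm u <= enorm v + enorm (u - v).
Proof. by rewrite -[in leLHS](subrK v u) addrC enormD// addrC. Qed.

(** The factor [sqrt m] occurs twice in the Lipschitz constant of the selection
    below, which makes it the dimension [m]. *)
Lemma enorm_sup u (c : R) : 0 <= c -> (forall i, `|u 0 i| <= c) ->
  enorm u <= Num.sqrt m%:R * c.
Proof.
move=> c0 uc.
rewrite -(@ler_pXn2r _ 2)// ?nnegrE ?enorm_ge0// ?mulr_ge0 ?sqrtr_ge0//.
rewrite enorm_sqr exprMn sqr_sqrtr ?ler0n// /dot.
apply: (@le_trans _ _ (\sum_(i < m) c ^+ 2)).
  apply: ler_sum => i _; rewrite -expr2 -real_normK ?num_real//.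
  by rewrite ler_pXn2r// nnegrE.
by rewrite sumr_const card_ord -[leLHS]mulr_natl.
Qed.

Lemma coord_norm u i : `|u 0 i| <= `|u|.
Proof.
rewrite [leRHS]/Num.norm /= mx_normrE.
by apply/bigmax_geP; right => /=; exists (0, i).
Qed.

Lemma enorm_norm u : enorm u <= Num.sqrt m%:R * `|u|.
Proof. by apply: enorm_sup => // i; exact: coord_norm. Qed.

Lemma norm_enorm u : `|u| <= enorm u.
Proof.
rewrite [leLHS]/Num.norm /= mx_normrE.
apply/bigmax_leP; split => [|[i j] _] /=; first exact: enorm_ge0.
by rewrite ord1 coord_enorm.
Qed.

Lemma enorm_near z (e : R) : 0 < e -> \forall x \near z, enorm (x - z) < e.
Proof.
move=> e0; have c0 : 0 <= Num.sqrt m%:R :> R by [].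
near=> x; rewrite (le_lt_trans (enorm_norm _))//.
have xz : `|x - z| < e / (Num.sqrt m%:R + 1).
  near: x; have /cvgrPdistC_lt := @cvg_id _ (nbhs z); apply.
  by rewrite divr_gt0// ltr_wpDl.
rewrite (@le_lt_trans _ _ ((Num.sqrt m%:R + 1) * `|x - z|))//.
  by rewrite mulrDl mul1r lerDl.
by rewrite mulrC -ltr_pdivlMr// ltr_wpDl.
Unshelve. all: by end_near. Qed.

Lemma enorm_cvgP T (F : set_system T) (f : T -> 'rV[R]_m) z : Filter F ->
  (f @ F --> z) <-> (forall e, 0 < e -> \forall t \near F, enorm (f t - z) < e).
Proof.
move=> FF; split=> [fz e e0|fz].
  exact: (fz _ (enorm_near z e0)).
apply/cvgrPdist_lt => e e0; near=> t.
rewrite distrC (le_lt_trans (norm_enorm _))//.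
by near: t; exact: fz.
Unshelve. all: by end_near. Qed.

Lemma enormB_continuous a : continuous (fun x : 'rV[R]_m => enorm (x - a)).
Proof.
move=> z; apply/(@cvgrPdist_lt _ _ _ _ (nbhs_filter z)) => e e0; near=> x.
have : enorm (x - z) < e by near: x; exact: enorm_near.
have := enorm_triangle z x a; have := enorm_triangle x z a.
rewrite (enormB z x) => h1 h2 h3.
by rewrite ltr_distlC; apply/andP; split; lra.
Unshelve. all: by end_near. Qed.

Lemma dot_continuous u : continuous (dot u).
Proof.
move=> z; apply/(@cvgrPdist_lt _ _ _ _ (nbhs_filter z)) => e e0; near=> x.
rewrite -dotBr (le_lt_trans (y := enorm u * enorm (z - x)))//.
  rewrite ler_norml cauchy_schwarz andbT lerNl -dotNl.
  by rewrite (le_trans (cauchy_schwarz _ _))// enormN.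
rewrite (@le_lt_trans _ _ ((enorm u + 1) * enorm (z - x)))//.
  by rewrite mulrDl mul1r lerDl enorm_ge0.
rewrite mulrC -ltr_pdivlMr ?ltr_wpDl ?enorm_ge0// enormB.
by near: x; apply: enorm_near; rewrite divr_gt0// ltr_wpDl ?enorm_ge0.
Unshelve. all: by end_near. Qed.

Lemma closed_enorm_le z (r : R) : closed [set x | enorm (x - z) <= r].
Proof.
apply: (@closed_comp _ _ (fun x => enorm (x - z)) [set t | t <= r]).
  by move=> x _; exact: enormB_continuous.
exact: closed_le.
Qed.

Lemma bounded_closed_compact_enorm (A : set 'rV[R]_m) z (r : R) :
  closed A -> (forall x, A x -> enorm (x - z) <= r) -> compact A.
Proof.
move=> cA Ar; apply: bounded_closed_compact cA.
exists (r + enorm z); split; first exact: num_real.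
move=> M rM x Ax /=; rewrite (le_trans (norm_enorm _))//.
rewrite (le_trans (enorm_leB x z))// (le_trans _ (ltW rM))// addrC lerD2r.
exact: Ar.
Qed.

Lemma compact_enorm_le z (r : R) : compact [set x | enorm (x - z) <= r].
Proof.
by apply: (@bounded_closed_compact_enorm _ z r) => //; exact: closed_enorm_le.
Qed.

End Euclidean.

Lemma continuous_min (R : realType) (T : topologicalType) (f : T -> R)
    (A : set T) : A !=set0 -> compact A -> continuous f ->
  exists2 c, A c & forall t, A t -> f c <= f t.
Proof.
move=> A0 cA cf.
have [|c /set_mem Ac fc] := compact_EVT_min A0 cA (f := f).
  exact: continuous_subspaceT.
by exists c => // t At; apply: fc; apply/mem_set.
Qed.
(** * Closed convex sets: nearest points and truncation *)

Lemma convex_setP (R : realType) (V : lmodType R) (K : set V) :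
  convex_set K <->
  (forall x y s, K x -> K y -> 0 <= s -> s <= 1 -> K (s *: x + (1 - s) *: y)).
Proof.
split=> [cK x y s Kx Ky s0 s1|cK x y s /set_mem Kx /set_mem Ky]; last first.
  by apply/mem_set; exact: cK.
have := cK x y (Itv01 s0 s1).
by move=> /(_ (mem_set Kx) (mem_set Ky)) /set_mem.
Qed.

Lemma convex_functionP (R : realType) (V : lmodType R) (h : V -> R) :
  convex_function [set: V] h <->
  (forall x y s, 0 <= s -> s <= 1 ->
    h (s *: x + (1 - s) *: y) <= s * h x + (1 - s) * h y).
Proof.
split=> [ch x y s s0 s1|ch s x y _ _]; last exact: ch.
exact: (ch (Itv01 s0 s1) x y (mem_set I) (mem_set I)).
Qed.

Lemma convex_set_mean (R : realType) (V : lmodType R) (K : set V)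
    (I : finType) (X : I -> V) : (0 < #|I|)%N ->
  convex_set K -> (forall i, K (X i)) -> K (#|I|%:R^-1 *: \sum_i X i).
Proof.
move=> I0 /convex_setP cK KX.
suff main (s : seq I) i : K ((size s).+1%:R^-1 *: \sum_(j <- i :: s) X j).
  move: I0; rewrite cardE -big_enum /=.
  by case: (enum I) => // i s _; exact: main.
elim: s i => [|j s IH] i.
  by rewrite big_seq1 invr1 scale1r.
rewrite big_cons scalerDr.
set N := (size s).+1.
have -> : (size (j :: s)).+1%:R^-1 *: \sum_(j0 <- j :: s) X j0 =
  (1 - N.+1%:R^-1) *: (N%:R^-1 *: \sum_(j0 <- j :: s) X j0) :> V.
  rewrite scalerA; congr (_ *: _); rewrite /= -/N -[N.+1%:R]natr1.
  have : 0 < N%:R :> R by rewrite ltr0n.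
  by move: (N%:R : R) => c c0; field; rewrite !gt_eqF ?addr_gt0.
apply: (cK _ _ _ (KX i) (IH j)); first by rewrite invr_ge0.
by rewrite invf_le1 ?ltr0n// ler1n.
Qed.

Section NearestPoint.
Context (R : realType) (m : nat).
Implicit Types (K L : set 'rV[R]_m) (a b x y z : 'rV[R]_m).

Lemma nearest_point K z : closed K -> K !=set0 ->
  exists2 z0, K z0 & forall y, K y -> enorm (z0 - z) <= enorm (y - z).
Proof.
move=> cK [k Kk]; pose A := K `&` [set x | enorm (x - z) <= enorm (k - z)].
have cA : compact A.
  apply: (@bounded_closed_compact_enorm _ _ _ z (enorm (k - z))) => [|x []//].
  by apply: closedI => //; exact: closed_enorm_le.
have [|c [Kc ck] cmin] := continuous_min _ cA (@enormB_continuous _ _ z).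
  by exists k; split => /=.
exists c => // y Ky; have [yk|/ltW ky] := leP (enorm (y - z)) (enorm (k - z)).
  by apply: cmin; split.
exact: le_trans ky.
Qed.

(** The variational inequality: moving from the nearest point towards [y] does
    not decrease the distance to first order. *)
Lemma projection K z : closed K -> convex_set K -> K !=set0 ->
  exists2 z0, K z0 & forall y, K y -> dot (z - z0) (y - z0) <= 0.
Proof.
move=> cK /convex_setP vK K0; have [z0 Kz0 z0min] := nearest_point z cK K0.
exists z0 => // y Ky; rewrite leNgt; apply/negP => d0.
set d := dot _ _ in d0; pose Q := dot (y - z0) (y - z0).
have Q0 : 0 <= Q by exact: dot_ge0.
(* the step at which the quadratic term is dominated by the linear one *)
pose s := Num.min 1 (d / (Q + 1)).
have s0 : 0 < s by rewrite lt_min ltr01 divr_gt0// ltr_wpDl.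
have s1 : s <= 1 by rewrite ge_min lexx.
have sQ : s * Q < d * 2.
  apply: (@le_lt_trans _ _ (d / (Q + 1) * Q)).
    by rewrite ler_wpM2r// ge_min lexx orbT.
  rewrite mulrAC ltr_pdivrMr ?ltr_wpDl//.
  by rewrite -mulrA ltr_pM2l//; lra.
have := z0min _ (vK _ _ _ Ky Kz0 (ltW s0) s1).
rewrite -(@ler_pXn2r _ 2)// ?nnegrE ?enorm_ge0// !enorm_sqr.
have -> : s *: y + (1 - s) *: z0 - z = s *: (y - z0) - (z - z0).
  by apply/rowP => i; rewrite !mxE; ring.
rewrite -(opprB z z0); move: @d @Q d0 Q0 @s s0 s1 sQ.
move: (y - z0) (z - z0) => q p d Q d0 Q0 s s0 s1 sQ.
rewrite !dotE (dotC q p) -/d -/Q => hmin.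
have : s * (s * Q) < s * (d * 2) by rewrite ltr_pM2l.
lra.
Qed.

(** Truncating at a multiple of the distance to [a], rather than at a fixed
    radius, gives a nonempty compact set that shrinks to [a] when [a] is in [K].
    With the factor 2, it contains points well inside the ball defining it. *)
Definition nearby K a : set 'rV[R]_m :=
  [set x | K x /\ forall y, K y -> enorm (x - a) <= 2 * enorm (y - a)].

Lemma nearby_nonempty K a : closed K -> K !=set0 -> nearby K a !=set0.
Proof.
move=> cK K0; have [x Kx xmin] := nearest_point a cK K0.
exists x; split=> // y Ky; rewrite (le_trans (xmin y Ky))//.
by rewrite ler_peMl ?enorm_ge0// ler1n.
Qed.

Lemma nearby_compact K a : closed K -> K !=set0 -> compact (nearby K a).
Proof.
move=> cK [k Kk].
apply: (@bounded_closed_compact_enorm _ _ _ a (2 * enorm (k - a))); last first.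
  by move=> x [_]; exact.
have -> : nearby K a = K `&`
    \bigcap_(y in K) [set x | enorm (x - a) <= 2 * enorm (y - a)].
  by apply/seteqP; split=> x.
by apply: closedI => //; apply: closed_bigI => y _; exact: closed_enorm_le.
Qed.

Lemma nearby_convex K a : convex_set K -> convex_set (nearby K a).
Proof.
move=> /convex_setP vK; apply/convex_setP => x y s [Kx xP] [Ky yP] s0 s1.
split=> [|k Kk]; first exact: vK.
have -> : s *: x + (1 - s) *: y - a = s *: (x - a) + (1 - s) *: (y - a).
  by apply/rowP => i; rewrite !mxE; ring.
rewrite (le_trans (enormD _ _))// !enormZ ger0_norm// ger0_norm ?subr_ge0//.
have := ler_wpM2l s0 (xP k Kk).
have s1' : 0 <= 1 - s by rewrite subr_ge0.
have := ler_wpM2l s1' (yP k Kk).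
lra.
Qed.

Lemma nearby_mem K a x : K a -> nearby K a x -> x = a.
Proof.
move=> Ka [_ /(_ a Ka)]; rewrite subrr enorm0 mulr0 => xa.
apply/eqP; rewrite -subr_eq0; apply/eqP/enorm0_eq0/eqP.
by rewrite eq_le xa enorm_ge0.
Qed.

(** Each set need only be close to the other on its own truncation, which makes
    the lemma usable for unbounded sets that are close only on bounded regions.
    A point of [K] is first moved by [D] into [L]; it then lies at distance at
    most [2 rho + 3 delta] from [b], where [rho] is the distance from [b] to [L],
    and sliding it towards the point of [L] nearest to [b] by the proportion
    [3 delta / (rho + 3 delta)] brings it into the ball of radius [2 rho]. *)
Lemma nearby_lipschitz K L a b (D : R) : closed K -> K !=set0 ->
  closed L -> convex_set L -> L !=set0 -> 0 <= D ->
  (forall x, nearby K a x -> exists2 z, L z & enorm (x - z) <= D) ->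
  (forall z, nearby L b z -> exists2 x, K x & enorm (z - x) <= D) ->
  forall x, nearby K a x ->
    exists2 z, nearby L b z & enorm (x - z) <= 10 * (D + enorm (a - b)).
Proof.
move=> cK K0 cL /convex_setP vL L0 D0 KL LK x Px.
have [x0 Kx0 x0min] := nearest_point a cK K0.
have [z0 Lz0 z0min] := nearest_point b cL L0.
have ab0 := enorm_ge0 (a - b).
set r := enorm (x0 - a) in x0min; set rho := enorm (z0 - b) in z0min.
set delta := D + enorm (a - b).
have delta0 : 0 <= delta by rewrite addr_ge0.
have rho0 : 0 <= rho by exact: enorm_ge0.
have r_rho : r <= rho + delta.
  have [|y Ky z0y] := LK z0.
    by split=> // y Ly; rewrite (le_trans (z0min y Ly))// ler_peMl ?enorm_ge0// ler1n.
  have := x0min y Ky; have := enorm_triangle z0 y a; have := enorm_triangle b z0 a.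
  rewrite (enormB b a) (enormB y z0) /rho /delta; lra.
have [z Lz xz] := KL x Px.
have zb : enorm (z - b) <= 2 * rho + 3 * delta.
  have [_ /(_ x0 Kx0)] := Px; rewrite -/r => xa.
  have := enorm_triangle x z b; have := enorm_triangle a x b.
  rewrite (enormB z x) /delta in r_rho *; lra.
have nearI y : L y -> enorm (y - b) <= 2 * rho -> nearby L b y.
  move=> Ly yb; split=> // y' Ly'; rewrite (le_trans yb)// ler_pM2l//.
  exact: z0min.
have [q0|] := ltP 0 (rho + 3 * delta); last first.
  move=> q0; have [rhoE deltaE] : rho = 0 /\ delta = 0 by split; lra.
  exists z; first by apply: nearI => //; move: zb; rewrite rhoE deltaE; lra.
  by move: xz; rewrite -/delta deltaE /delta; move: deltaE; rewrite /delta; lra.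
set q := rho + 3 * delta in q0.
pose s := 3 * delta / q.
have sq : s * q = 3 * delta by rewrite /s divfK ?gt_eqF.
have s0 : 0 <= s by rewrite divr_ge0 ?mulr_ge0// ltW.
have s1 : s <= 1 by rewrite ler_pdivrMr// mul1r /q lerDr.
have s1' : 0 <= 1 - s by rewrite subr_ge0.
exists (s *: z0 + (1 - s) *: z).
  apply: nearI; first exact: vL.
  have -> : s *: z0 + (1 - s) *: z - b = s *: (z0 - b) + (1 - s) *: (z - b).
    by apply/rowP => i; rewrite !mxE; ring.
  rewrite (le_trans (enormD _ _))// !enormZ ger0_norm// ger0_norm// -/rho.
  have := ler_wpM2l s1' zb; move: sq; rewrite /q; lra.
rewrite (le_trans (enorm_triangle z _ _))//.
have -> : z - (s *: z0 + (1 - s) *: z) = s *: (z - z0).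
  by apply/rowP => i; rewrite !mxE; ring.
rewrite enormZ ger0_norm//.
have zz0 : enorm (z - z0) <= 3 * q.
  by have := enorm_triangle b z z0; rewrite (enormB b z0) -/rho /q; lra.
have := ler_wpM2l s0 zz0; rewrite mulrCA sq.
by move: xz; rewrite /delta; lra.
Qed.

End NearestPoint.
(** * A Lipschitz selection of compact convex sets *)

Section SupportFunction.
Context (R : realType) (m : nat).
Implicit Types (P Q : set 'rV[R]_m) (u x : 'rV[R]_m).

Definition supp P u : R := sup [set dot u x | x in P].

Lemma supp_attained P u : compact P -> P !=set0 ->
  exists2 x, P x & dot u x = supp P u /\ forall y, P y -> dot u y <= supp P u.
Proof.
move=> cP P0; have [|x Px xmin] := continuous_min P0 cP (f := dot (- u)).
  exact: dot_continuous.
have ux y : P y -> dot u y <= dot u x.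
  by move=> /xmin; rewrite !dotNl lerN2.
have suppE : dot u x = supp P u.
  apply/eqP; rewrite eq_le; apply/andP; split.
    apply: sup_upper_bound; last by exists x.
    split; first by exists (dot u x), x.
    by exists (dot u x) => _ [y Py <-]; exact: ux.
  apply: sup_le_ub; first by exists (dot u x), x.
  by move=> _ [y Py <-]; exact: ux.
by exists x => //; split=> // y Py; rewrite -suppE; exact: ux.
Qed.

Lemma supp_le P Q u (d : R) : compact P -> P !=set0 -> compact Q -> Q !=set0 ->
  (forall x, P x -> exists2 z, Q z & enorm (x - z) <= d) ->
  supp P u <= supp Q u + enorm u * d.
Proof.
move=> cP P0 cQ Q0 PQ; have [x Px [<- _]] := supp_attained u cP P0.
have [_ _ [_ Qle]] := supp_attained u cQ Q0.
have [z Qz xz] := PQ x Px; rewrite -(subrK z x) dotDr addrC lerD ?Qle//.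
by rewrite (le_trans (cauchy_schwarz _ _))// ler_wpM2l ?enorm_ge0.
Qed.

End SupportFunction.

Section DiscreteSteiner.
Context (R : realType) (m N : nat).
Local Notation index := {ffun 'I_m -> 'I_N.+2}.
Implicit Types (P Q : set 'rV[R]_m) (k : index) (i j : 'I_m).

(** The cube [[-1, 1]^m] is symmetric so that the two faces orthogonal to a
    direction contribute equally to the Lipschitz constant; a cube with a vertex
    at 0 would give a larger one. *)
Definition grid k : 'rV[R]_m := \row_j (2 * (k j)%:R / N.+1%:R - 1).

(** One step along direction [i]; wrapping around at the last face makes it a
    permutation, so that telescoping sums become invariance under reindexing. *)
Definition shift i k : index := [ffun j => if j == i then ordS (k j) else k j].

Definition face_card i : nat := #|[pred k : index | k i == ord_max]|.

(** Half the difference between the means of the support function over the two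
    faces orthogonal to direction [i], which for a fine grid is close to the mean
    over the cube of its [i]th partial derivative. *)
Definition steiner_approx P : 'rV[R]_m :=
  \row_i ((2 * (face_card i)%:R)^-1 *
    \sum_(k : index | k i == ord_max)
      (supp P (grid k) - supp P (grid (shift i k)))).

Lemma shift_inj i : injective (shift i).
Proof.
move=> k k' /ffunP kk'; apply/ffunP => j; have := kk' j; rewrite !ffunE.
by case: eqP => // _ /ordS_inj.
Qed.

Lemma face_cardE i : (face_card i * N.+2)%N = #|{: index}|.
Proof.
have cardE (c : 'I_N.+2) : #|[pred k : index | k i == c]| = face_card i.
  pose g k : index := [ffun j => if j == i then tperm c ord_max (k j) else k j].
  have gK : involutive g.
    by move=> k; apply/ffunP => j; rewrite !ffunE; case: eqP => // _; rewrite tpermK.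
  rewrite /face_card -!sum1_card (reindex_inj (inv_inj gK)) /=; apply: eq_bigl => k.
  by rewrite !inE ffunE eqxx -[X in _ == X](tpermR c ord_max) (inj_eq perm_inj).
rewrite -[RHS]sum1_card (partition_big (fun k : index => k i) predT)//=.
rewrite (eq_bigr (fun=> face_card i)); last first.
  by move=> c _; rewrite -(cardE c) -sum1_card; apply: eq_bigl => k; rewrite !inE.
by rewrite sum_nat_const card_ord mulnC.
Qed.

Lemma card_index_gt0 : (0 < #|{: index}|)%N.
Proof. by apply/card_gt0P; exists [ffun=> ord0]. Qed.

Lemma face_card_gt0 i : (0 < face_card i)%N.
Proof. by have := card_index_gt0; rewrite -(face_cardE i) muln_gt0 => /andP[]. Qed.

Lemma enorm_grid k : enorm (grid k) <= Num.sqrt m%:R.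
Proof.
rewrite -[leRHS]mulr1; apply: enorm_sup => // j; rewrite mxE.
have N0 : 0 < N.+1%:R :> R by [].
have kN : (k j)%:R <= N.+1%:R :> R by rewrite ler_nat -ltnS.
have k0 : 0 <= (k j)%:R :> R by [].
have : 2 * (k j)%:R / N.+1%:R <= 2 :> R by rewrite ler_pdivrMr// ler_pM2l.
have : 0 <= 2 * (k j)%:R / N.+1%:R :> R by rewrite divr_ge0// mulr_ge0.
move: (2 * _ / _ : R) => t h1 h2.
by rewrite ler_norml; apply/andP; split; lra.
Qed.

(** On the cube the support functions differ by at most [sqrt m * d], and so does
    every coordinate of the approximate point; the Euclidean norm contributes
    another factor [sqrt m]. *)
Lemma steiner_approx_lipschitz P Q (d : R) : 0 <= d ->
  compact P -> P !=set0 -> compact Q -> Q !=set0 ->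
  (forall x, P x -> exists2 z, Q z & enorm (x - z) <= d) ->
  (forall x, Q x -> exists2 z, P z & enorm (x - z) <= d) ->
  enorm (steiner_approx P - steiner_approx Q) <= m%:R * d.
Proof.
move=> d0 cP P0 cQ Q0 PQ QP; set c := Num.sqrt m%:R * d.
have suppB k : `|supp P (grid k) - supp Q (grid k)| <= c.
  have gd : enorm (grid k) * d <= c by rewrite ler_wpM2r// enorm_grid.
  have := supp_le (grid k) cP P0 cQ Q0 PQ.
  have := supp_le (grid k) cQ Q0 cP P0 QP.
  by rewrite ler_norml => h1 h2; apply/andP; split; lra.
have -> : m%:R * d = Num.sqrt m%:R * c :> R.
  by rewrite mulrA -expr2 sqr_sqrtr// ler0n.
apply: enorm_sup => [|i]; first by rewrite mulr_ge0.
have W0 : 0 < (face_card i)%:R :> R by rewrite ltr0n face_card_gt0.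
rewrite !mxE -mulrBr -sumrB normrM gtr0_norm ?invr_gt0 ?mulr_gt0//.
rewrite mulrC ler_pdivrMr ?mulr_gt0// (le_trans (ler_norm_sum _ _ _))//.
apply: (@le_trans _ _ (\sum_(k : index | k i == ord_max) (2 * c))).
  apply: ler_sum => k _; have := suppB k; have := suppB (shift i k).
  by rewrite !ler_norml => /andP[? ?] /andP[? ?]; apply/andP; split; lra.
rewrite sumr_const -[_ *+ _]mulr_natr.
by rewrite mulrAC mulrC.
Qed.

Lemma grid_shift i k : k i != ord_max ->
  grid (shift i k) = grid k + (2 / N.+1%:R) *: delta_mx 0 i.
Proof.
move=> ki; apply/rowP => j; rewrite !mxE eqxx ffunE /=.
have [->|ji] := eqVneq j i; last by rewrite mulr0 addr0.
have kiN : (k i < N.+1)%N.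
  rewrite ltn_neqAle -ltnS ltn_ord andbT.
  by apply: contraNneq ki => ki; exact/eqP/val_inj.
rewrite /= modn_small// -natr1.
have : 0 < N.+1%:R :> R by [].
by move: (N.+1%:R : R) => n n0; field; rewrite gt_eqF.
Qed.

Lemma dot_delta i x : dot (delta_mx 0 i) x = x 0 i :> R.
Proof.
rewrite /dot (bigD1 i)//= big1 => [|j ji].
  by rewrite mxE !eqxx mul1r addr0.
by rewrite mxE (negbTE ji) andbF mul0r.
Qed.

(** Summing differences over the whole cyclic grid gives 0, so the steps that wrap
    around balance all the others. *)
Lemma face_sum i (phi : index -> R) :
  \sum_(k : index | k i == ord_max) (phi k - phi (shift i k)) =
  \sum_(k : index | k i != ord_max) (phi (shift i k) - phi k).
Proof.
have : \sum_(k : index) phi k = \sum_(k : index) phi (shift i k).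
  by rewrite (reindex_inj (@shift_inj i)).
rewrite (bigID (fun k : index => k i == ord_max))/=.
rewrite [in RHS](bigID (fun k : index => k i == ord_max))/= !sumrB; lra.
Qed.

(** Let [X k] maximize [dot (grid k)] over [P].  A step of the support function in
    direction [i] lies between [2 / N.+1] times the [i]th coordinates of the
    maximizers at its two ends.  Hence the approximate point is close to the mean
    of all the maximizers, which belongs to [P]; the error only involves the
    maximizers on one face, a proportion [1 / N.+2] of the grid. *)
Lemma steiner_approx_near P (rho : R) : compact P -> P !=set0 -> convex_set P ->
  (forall x i, P x -> `|x 0 i| <= rho) ->
  exists2 x, P x &
    forall i, `|steiner_approx P 0 i - x 0 i| <= 2 * rho / N.+1%:R.
Proof.
move=> cP P0 vP Prho.
have /choice[X XP] : forall k, exists x, P x /\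
    (dot (grid k) x = supp P (grid k) /\
     forall y, P y -> dot (grid k) y <= supp P (grid k)).
  by move=> k; have [x Px ?] := supp_attained (grid k) cP P0; exists x.
exists (#|{: index}|%:R^-1 *: \sum_k X k).
  by apply: convex_set_mean => [|//|k]; [exact: card_index_gt0|have [] := XP k].
move=> i; rewrite !mxE summxE face_sum.
set S := \sum_(k | _) _; set Tot := \sum_k _.
set W : R := (face_card i)%:R.
have W0 : 0 < W by rewrite ltr0n face_card_gt0.
set n : R := N.+1%:R; have n0 : 0 < n by [].
have cardE : #|{: index}|%:R = W * (n + 1).
  by rewrite -(face_cardE i) natrM -[N.+2%:R]natr1.
have faceB (phi : index -> R) : (forall k, `|phi k| <= rho) ->
    `|\sum_(k : index | k i == ord_max) phi k| <= W * rho.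
  move=> phir; rewrite (le_trans (ler_norm_sum _ _ _))//.
  rewrite (le_trans (ler_sum _ (fun k _ => phir k)))//.
  by rewrite sumr_const -[_ *+ _]mulr_natl.
have XB k : `|X k 0 i| <= rho by apply: Prho; have [] := XP k.
have TotB : `|Tot| <= W * (n + 1) * rho.
  rewrite (le_trans (ler_norm_sum _ _ _))//.
  rewrite (le_trans (ler_sum _ (fun k _ => XB k)))//.
  by rewrite sumr_const -[_ *+ _]mulr_natl cardE.
have lower : 2 / n * (Tot - W * rho) <= S.
  apply: (@le_trans _ _ (\sum_(k : index | k i != ord_max) (2 / n * X k 0 i))).
    rewrite -mulr_sumr ler_pM2l ?divr_gt0//.
    rewrite /Tot (bigID (fun k : index => k i == ord_max))/=.
    by have := faceB _ XB; rewrite ler_norml => /andP[_ ?]; lra.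
  apply: ler_sum => k ki; have [Pk [<- _]] := XP k.
  have [_ [_ /(_ _ Pk)]] := XP (shift i k).
  by rewrite grid_shift// dotDl dotZl dot_delta lerBrDl.
have upper : S <= 2 / n * (Tot + W * rho).
  apply: (@le_trans _ _
    (\sum_(k : index | k i != ord_max) (2 / n * X (shift i k) 0 i))).
    apply: ler_sum => k ki; have [Pk [<- _]] := XP (shift i k).
    have [_ [_ /(_ _ Pk)]] := XP k.
    by rewrite grid_shift// dotDl dotZl dot_delta addrAC gerDr subr_le0.
  rewrite -mulr_sumr ler_pM2l ?divr_gt0//.
  have -> : Tot = \sum_k X (shift i k) 0 i.
    by rewrite /Tot (reindex_inj (@shift_inj i)).
  rewrite [X in _ <= X + _](bigID (fun k : index => k i == ord_max))/=.
  have /= := faceB (fun k => X (shift i k) 0 i) (fun k => XB _).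
  by rewrite ler_norml => /andP[? _]; lra.
have n10 : 0 < n + 1 by lra.
pose t := Tot / W; pose s := S / W.
have tE : Tot = W * t by rewrite /t mulrC divfK ?gt_eqF.
have sE : S = W * s by rewrite /s mulrC divfK ?gt_eqF.
rewrite cardE.
have -> : (2 * W)^-1 * S - (W * (n + 1))^-1 * Tot = s / 2 - t / (n + 1).
  by rewrite tE sE; field; rewrite !gt_eqF.
move: lower upper TotB; rewrite tE sE normrM gtr0_norm//.
have -> : 2 / n * (W * t - W * rho) = W * (2 / n * (t - rho)) by ring.
have -> : 2 / n * (W * t + W * rho) = W * (2 / n * (t + rho)) by ring.
rewrite -!(mulrA W) !ler_pM2l// => lower upper tB.
have {}tB : `|t / (n + 1)| <= rho.
  by rewrite normrM normfV (gtr0_norm n10) ler_pdivrMr// mulrC.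
have tnE : t / (n + 1) * n = t - t / (n + 1).
  by field; rewrite gt_eqF.
have {}lower : 2 * (t - rho) <= s * n.
  by rewrite -ler_pdivrMr// mulrAC.
have {}upper : s * n <= 2 * (t + rho).
  by rewrite -ler_pdivlMr// mulrAC.
rewrite ler_pdivlMr// -[X in _ * X](gtr0_norm n0) -normrM mulrBl tnE.
move: tB; rewrite !ler_norml => /andP[? ?].
by apply/andP; split; lra.
Qed.

End DiscreteSteiner.
Section SteinerPoint.
Context (R : realType) (m : nat).
Implicit Types (P Q : set 'rV[R]_m).

Definition free_ultrafilter : set_system nat :=
  projT1 (cid (ultraFilterLemma eventually_filter)).

#[local] Instance free_ultrafilter_ultra : UltraFilter free_ultrafilter.
Proof. by rewrite /free_ultrafilter; case: cid => U []. Qed.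

Lemma free_ultrafilter_eventually : \oo `<=` free_ultrafilter.
Proof. by rewrite /free_ultrafilter; case: cid => U []. Qed.

(** One ultrafilter serves all sets, so that inequalities between the approximate
    points of two sets pass to the limit. *)
Definition steiner P : 'rV[R]_m :=
  lim (steiner_approx N P @[N --> free_ultrafilter]).

Lemma ultrafilter_cvg T (U : set_system T) (V : ptopologicalType) (f : T -> V)
    (A : set V) : UltraFilter U -> compact A -> (forall t, A (f t)) ->
  cvg (f @ U).
Proof.
move=> UU cA Af; have UP : ProperFilter U := ultra_proper.
have fA : (f @ U) A by exact: (@filterE _ U).
have [p [Ap fp]] := cA (f @ U) _ fA.
apply/cvg_ex; exists p => B pB.
have [//|nB] := in_ultra_setVsetC (f @^-1` B) UU.
by have [x [nBx /nBx]] := fp (~` B) B nB pB.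
Qed.

Lemma compact_coord_bounded P : compact P ->
  exists2 rho : R, 0 <= rho & forall x i, P x -> `|x 0 i| <= rho.
Proof.
move=> /compact_bounded[r [_ /(_ (`|r| + 1)) Pr]].
exists (`|r| + 1) => [|x i Px]; first by rewrite addr_ge0.
rewrite (le_trans (coord_norm x i))//; apply: Pr => //.
by rewrite (le_lt_trans (ler_norm r))// ltrDl.
Qed.

Lemma steiner_approx_cvg P : compact P -> P !=set0 -> convex_set P ->
  steiner_approx N P @[N --> free_ultrafilter] --> steiner P.
Proof.
move=> cP P0 vP; have [rho rho0 Pr] := compact_coord_bounded cP.
pose A := [set x : 'rV[R]_m | enorm (x - 0) <= Num.sqrt m%:R * (3 * rho)].
apply: (@ultrafilter_cvg _ _ _ _ A); first exact: compact_enorm_le.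
move=> N; rewrite /A /= subr0; apply: enorm_sup => [|i]; first by rewrite mulr_ge0.
have [x Px /(_ i) xN] := steiner_approx_near N cP P0 vP Pr.
have xr := Pr x i Px.
have N2 : 2 * rho / N.+1%:R <= 2 * rho.
  by rewrite ler_pdivrMr// ler_peMr ?mulr_ge0// ler1n.
rewrite -(subrK (x 0 i) (_ 0 i)) (le_trans (ler_normD _ _))//.
have := le_trans xN N2; lra.
Qed.

(** The approximate points and the points of [P] close to them have the same
    limit. *)
Lemma steiner_mem P : compact P -> P !=set0 -> convex_set P -> P (steiner P).
Proof.
move=> cP P0 vP; have [rho rho0 Pr] := compact_coord_bounded cP.
have sP := steiner_approx_cvg cP P0 vP.
have /choice[x xP] : forall N, exists x, P x /\
    forall i, `|steiner_approx N P 0 i - x 0 i| <= 2 * rho / N.+1%:R.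
  by move=> N; have [x Px ?] := steiner_approx_near N cP P0 vP Pr; exists x.
have Pclosed : closed P by apply: compact_closed cP; exact: norm_hausdorff.
apply: (@closed_cvg _ _ free_ultrafilter _ x) => //.
  by apply: nearW => N; have [] := xP N.
apply/enorm_cvgP => e e0.
have c0 : 0 <= Num.sqrt m%:R * (2 * rho) by rewrite !mulr_ge0.
have d0 : 0 < e / 2 / (Num.sqrt m%:R * (2 * rho) + 1).
  by apply: divr_gt0; [exact: divr_gt0|exact: ltr_wpDl c0 ltr01].
near=> N.
rewrite (le_lt_trans (enorm_triangle (steiner_approx N P) _ _))//.
have N0 : 0 < N.+1%:R :> R by [].
rewrite (splitr e) ltrD//; last first.
  by near: N; apply: (iffLR (enorm_cvgP _ _ _) sP); rewrite divr_gt0.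
rewrite enormB (le_lt_trans (enorm_sup (c := 2 * rho / N.+1%:R) _ _))//.
- by rewrite divr_ge0 ?mulr_ge0.
- move=> i; have [_ /(_ i)] := xP N.
  by move: (steiner_approx N P) => y; rewrite !mxE.
rewrite mulrA (@le_lt_trans _ _ ((Num.sqrt m%:R * (2 * rho) + 1) * N.+1%:R^-1))//.
  by rewrite ler_wpM2r// lerDl.
rewrite mulrC -ltr_pdivlMr ?(ltr_wpDl c0 ltr01)//; near: N.
apply: free_ultrafilter_eventually.
exact: (near_infty_natSinv_lt (PosNum d0)).
Unshelve. all: by end_near. Qed.

Lemma steiner_lipschitz P Q (d : R) : 0 <= d ->
  compact P -> P !=set0 -> convex_set P ->
  compact Q -> Q !=set0 -> convex_set Q ->
  (forall x, P x -> exists2 z, Q z & enorm (x - z) <= d) ->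
  (forall x, Q x -> exists2 z, P z & enorm (x - z) <= d) ->
  enorm (steiner P - steiner Q) <= m%:R * d.
Proof.
move=> d0 cP P0 vP cQ Q0 vQ PQ QP.
have sPQ : (steiner_approx N P - steiner_approx N Q) @[N --> free_ultrafilter]
    --> steiner P - steiner Q.
  by apply: cvgB; exact: steiner_approx_cvg.
pose A := [set x : 'rV[R]_m | enorm (x - 0) <= m%:R * d].
suff : A (steiner P - steiner Q) by rewrite /A /= subr0.
apply: closed_cvg sPQ; first exact: closed_enorm_le.
by apply: nearW => N; rewrite /A /= subr0; exact: steiner_approx_lipschitz.
Qed.

End SteinerPoint.
(** * Epigraph of the conjugate of a convex function *)

Section Pack.
Context (R : realType) (n : nat).
Implicit Types (z y : 'rV[R]_n.+1) (v p : 'rV[R]_n) (s : R).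

(** A point of the epigraph of a function of [v] is encoded with its height as
    coordinate 0, followed by [v], called its slope because the function in
    question is a conjugate. *)
Definition height z : R := z 0 ord0.
Definition slope z : 'rV[R]_n := \row_i z 0 (lift ord0 i).
Definition pack s v : 'rV[R]_n.+1 :=
  \row_i (if unlift ord0 i is Some j then v 0 j else s).

Lemma height_pack s v : height (pack s v) = s.
Proof. by rewrite /height mxE unlift_none. Qed.

Lemma slope_pack s v : slope (pack s v) = v.
Proof. by apply/rowP => i; rewrite !mxE liftK. Qed.

Lemma slopeD z y : slope (z + y) = slope z + slope y.
Proof. by apply/rowP => i; rewrite !mxE. Qed.

Lemma slopeZ s z : slope (s *: z) = s *: slope z.
Proof. by apply/rowP => i; rewrite !mxE. Qed.

Lemma slopeB z y : slope (z - y) = slope z - slope y.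
Proof. by apply/rowP => i; rewrite !mxE. Qed.

Lemma heightD z y : height (z + y) = height z + height y.
Proof. by rewrite /height mxE. Qed.

Lemma heightZ s z : height (s *: z) = s * height z.
Proof. by rewrite /height mxE. Qed.

Lemma heightB z y : height (z - y) = height z - height y.
Proof. by rewrite /height !mxE. Qed.

Lemma dot_slope z y : dot z y = height z * height y + dot (slope z) (slope y).
Proof.
rewrite /dot big_ord_recl; congr (_ + _).
by apply: eq_bigr => i _; rewrite !mxE.
Qed.

Lemma height_le z : `|height z| <= enorm z.
Proof. exact: coord_enorm. Qed.

Lemma slope_le z : enorm (slope z) <= enorm z.
Proof.
rewrite -(@ler_pXn2r _ 2)// ?nnegrE ?enorm_ge0// !enorm_sqr (dot_slope z).
by rewrite lerDr -expr2 sqr_ge0.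
Qed.

Lemma slope_continuous : continuous slope.
Proof.
move=> z; apply/(enorm_cvgP _ _ (nbhs_filter z)) => e e0; near=> x.
rewrite -slopeB (le_lt_trans (slope_le _))//.
by near: x; exact: enorm_near.
Unshelve. all: by end_near. Qed.

Lemma height_continuous : continuous height.
Proof. exact: coord_continuous. Qed.

Lemma dot_pack p z : dot (pack (- 1) p) z = dot p (slope z) - height z.
Proof. by rewrite dot_slope height_pack slope_pack mulN1r addrC. Qed.

Lemma le_enorm_pack p s : enorm p <= enorm (pack s p).
Proof. by rewrite -{1}(slope_pack s p) slope_le. Qed.

Lemma ge1_enorm_pack p : 1 <= enorm (pack 1 p).
Proof.
by rewrite (le_trans _ (height_le _))// height_pack normr1.
Qed.

Lemma enorm_pack_le p s : enorm (pack s p) <= `|s| + enorm p.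
Proof.
rewrite -(@ler_pXn2r _ 2)// ?nnegrE ?addr_ge0 ?enorm_ge0//.
rewrite enorm_sqr dot_slope height_pack slope_pack sqrrD enorm_sqr.
rewrite real_normK ?num_real// -expr2 lerD2r lerDl mulrn_wge0//.
by rewrite mulr_ge0 ?enorm_ge0.
Qed.

End Pack.

Section ConjugateEpigraph.
Context (R : realType) (n : nat).
Implicit Types (h : 'rV[R]_n -> R) (p v : 'rV[R]_n) (z y : 'rV[R]_n.+1).

(** The epigraph of the Legendre-Fenchel conjugate of [h], as an intersection of
    half-spaces. *)
Definition conj_epi h : set 'rV[R]_n.+1 :=
  [set z | forall p, dot p (slope z) - height z <= h p].

Lemma conj_epi_closed h : closed (conj_epi h).
Proof.
have -> : conj_epi h = \bigcap_(p in setT) [set z | dot (pack (- 1) p) z <= h p].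
  apply/seteqP; split=> z hz p; first by move=> _; rewrite /= dot_pack.
  by have := hz p I; rewrite /= dot_pack.
apply: closed_bigI => p _.
apply: (@closed_comp _ _ (dot (pack (- 1) p)) [set t | t <= h p]).
  by move=> x _; exact: dot_continuous.
exact: closed_le.
Qed.

Lemma conj_epi_convex h : convex_set (conj_epi h).
Proof.
apply/convex_setP => z y s hz hy s0 s1 p.
rewrite slopeD heightD !slopeZ !heightZ !dotE.
have s1' : 0 <= 1 - s by rewrite subr_ge0.
have := ler_wpM2l s0 (hz p); have := ler_wpM2l s1' (hy p); lra.
Qed.

Lemma conj_epi_up h z s : 0 <= s -> conj_epi h z ->
  conj_epi h (pack (height z + s) (slope z)).
Proof.
by move=> s0 hz p; rewrite height_pack slope_pack; have := hz p; lra.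
Qed.

(** The Fenchel-Moreau theorem for finite functions: the normal vector at the
    point of the epigraph of [h] nearest to [(p, c)] is not horizontal because
    [h] is finite at [p], so it defines an affine minorant of [h]. *)
Lemma fenchel_moreau h p c : continuous h -> convex_function [set: 'rV[R]_n] h ->
  c < h p -> exists2 z, conj_epi h z & c <= dot p (slope z) - height z.
Proof.
move=> hc /convex_functionP hv cp.
pose G : set 'rV[R]_n.+1 := [set y | h (slope y) <= height y].
have Gv : convex_set G.
  apply/convex_setP => x y s; rewrite /G /= => Gx Gy s0 s1.
  rewrite slopeD heightD !slopeZ !heightZ (le_trans (hv _ _ _ s0 s1))//.
  by rewrite lerD// ler_wpM2l// subr_ge0.
have Gc : closed G.
  have -> : G = [set y | h (slope y) - height y <= 0].
    by apply/seteqP; split=> y; rewrite /G /= subr_le0.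
  apply: (@closed_comp _ _ (fun y => h (slope y) - height y) [set t | t <= 0]).
    move=> y _; apply: (@cvgB _ _ _ (nbhs y) _ (h \o @slope R n) (@height R n)).
      apply: (@continuous_comp _ _ _ (@slope R n) h y); last exact: hc.
      exact: slope_continuous.
    exact: height_continuous.
  exact: closed_le.
have Gp q s : h q <= s -> G (pack s q).
  by rewrite /G /= height_pack slope_pack.
have [|y Gy yP] := projection (pack c p) Gc Gv.
  by exists (pack (h p) p); exact: Gp.
have {}yP q s : h q <= s ->
    (c - height y) * (s - height y) + dot (p - slope y) (q - slope y) <= 0.
  move=> /Gp/yP; rewrite dot_slope.
  by rewrite !heightB !slopeB !height_pack !slope_pack.
have Gy' : h (slope y) <= height y by exact: Gy.
have yc : c <= height y.
  have := yP (slope y) (height y + 1); rewrite subrr dot0r => H.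
  have {H} := H ltac:(by rewrite (le_trans Gy')// lerDl); lra.
have {}yc : c < height y.
  rewrite lt_neqAle yc andbT; apply/eqP => cE.
  have := yP p (h p) (lexx _); rewrite cE subrr mul0r add0r -enorm_sqr => H.
  have /eqP : enorm (p - slope y) ^+ 2 == 0 by rewrite eq_le H sqr_ge0.
  move/eqP; rewrite sqrf_eq0 => /eqP/enorm0_eq0/eqP.
  rewrite subr_eq0 => /eqP pE; move: cp; rewrite cE {1}pE; lra.
pose b := height y - c; have b0 : 0 < b by rewrite subr_gt0.
have b0' : b != 0 by rewrite gt_eqF.
exists (pack (dot (slope y) (b^-1 *: (p - slope y)) - height y)
             (b^-1 *: (p - slope y))).
  move=> q; rewrite slope_pack height_pack.
  have := yP q (h q) (lexx _); rewrite -(opprB (height y)) -/b => H.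
  rewrite -(ler_pM2l b0) !dotZr mulrBr mulrBr !mulVKf//.
  by move: H; rewrite dotBr (dotC _ q) (dotC _ (slope y)); lra.
rewrite slope_pack height_pack opprB addrCA -dotBl dotZr.
rewrite (le_trans (ltW yc))// lerDl mulr_ge0 ?invr_ge0 ?(ltW b0)//.
exact: dot_ge0.
Qed.

Lemma fenchel_le h p c : continuous h -> convex_function [set: 'rV[R]_n] h ->
  (forall z, conj_epi h z -> dot p (slope z) - height z <= c) -> h p <= c.
Proof.
move=> hc hv zc; rewrite leNgt; apply/negP => cp.
have [|z /zc hz] := @fenchel_moreau h p ((c + h p) / 2) hc hv; lra.
Qed.

(** Comparing [h] on directions [p] amounts to comparing support functions on
    the nonhorizontal directions [(-1, p)], so a pointwise bound on [h] controls
    the distance to its conjugate epigraph.  The normal vector at the nearest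
    point can be horizontal; it is then a limit of the directions [(-1, s p)]
    for large [s]. *)
Lemma conj_epi_near h z (d : R) : continuous h ->
  convex_function [set: 'rV[R]_n] h -> 0 <= d ->
  (forall p, dot p (slope z) - height z <= h p + d * enorm (pack 1 p)) ->
  exists2 y, conj_epi h y & enorm (z - y) <= d.
Proof.
move=> hc hv d0 zd.
have [|y0 hy0 _] := @fenchel_moreau h 0 (h 0 - 1) hc hv; first by lra.
have [|y hy yP] := projection z (@conj_epi_closed h) (@conj_epi_convex h).
  by exists y0.
exists y => //; pose e := enorm (z - y); rewrite -/e.
have e0 : 0 <= e by exact: enorm_ge0.
suff ed : e ^+ 2 <= d * e.
  have [/eqP->//|en0] := boolP (e == 0).
  by rewrite -(@ler_pM2r _ e) ?lt0r ?en0// -expr2.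
pose q := height y - height z; pose p := slope z - slope y.
have eE : e ^+ 2 = q ^+ 2 + dot p p.
  by rewrite enorm_sqr dot_slope heightB slopeB -/p -(opprB (height y)) mulrNN -expr2.
have {}yP x : conj_epi h x -> dot p (slope x - slope y) <= q * (height x - height y).
  move=> /yP; rewrite dot_slope !heightB !slopeB -/p -(opprB (height y)) -/q; lra.
have q0 : 0 <= q.
  have := yP _ (conj_epi_up ler01 hy).
  by rewrite height_pack slope_pack subrr dot0r; lra.
have zy : slope z = p + slope y by rewrite subrK.
move: q0; rewrite le_eqVlt => /orP[/eqP qE|q0].
  have pE : dot p p = e ^+ 2 by rewrite eE -qE expr0n add0r.
  have pe : enorm p = e.
    by apply/eqP; rewrite -(@eqrXn2 _ 2)// ?enorm_ge0// enorm_sqr pE.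
  rewrite leNgt; apply/negP => ed.
  have main s : 0 < s -> s * (e ^+ 2 - d * e) <= height z + h 0 + d.
    move=> s0; have hs : h (s *: p) <= s * dot p (slope y) + h 0.
      apply: fenchel_le => // x hx; have := yP x hx; have := hx 0.
      rewrite dot0l -qE mul0r dotBr subr_le0 dotZl => x0 xy.
      by have := ler_wpM2l (ltW s0) xy; lra.
    have := zd (s *: p); rewrite zy dotDr !dotZl pE.
    have := ler_wpM2l d0 (enorm_pack_le (s *: p) 1).
    by rewrite enormZ pe normr1 gtr0_norm//; lra.
  have X0 : 0 < e ^+ 2 - d * e by rewrite subr_gt0.
  pose C := `|height z + h 0 + d| + 1.
  have C0 : 0 < C by rewrite ltr_wpDl.
  have := main (C / (e ^+ 2 - d * e)) ltac:(by rewrite divr_gt0).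
  rewrite divfK ?gt_eqF// /C; have := ler_norm (height z + h 0 + d); lra.
have q0' : q != 0 by rewrite gt_eqF.
have hp : h (q^-1 *: p) <= dot (q^-1 *: p) (slope y) - height y.
  apply: fenchel_le => // x /yP; rewrite dotBr mulrBr => xy.
  by rewrite -(ler_pM2l q0) !dotZl !mulrBr !mulVKf//; lra.
have := zd (q^-1 *: p); rewrite zy dotDr !dotZl => zq.
have {zq hp} : q^-1 * dot p p + q <= d * enorm (pack 1 (q^-1 *: p)).
  by move: hp; rewrite dotZl /q; lra.
have -> : pack 1 (q^-1 *: p) = q^-1 *: pack q p.
  by apply/rowP => i; rewrite !mxE; case: unliftP => [j _|_]; rewrite ?mxE// mulVf.
rewrite enormZ gtr0_norm ?invr_gt0// -(ler_pM2l q0).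
have -> : enorm (pack q p) = e.
  apply/eqP; rewrite -(@eqrXn2 _ 2)// ?enorm_ge0// enorm_sqr dot_slope.
  by rewrite height_pack slope_pack eE -expr2.
by rewrite mulrDr mulVKf// mulrCA mulVKf// eE expr2; lra.
Qed.

End ConjugateEpigraph.
(** * The parametrization and its stability *)

Section Parametrization.
Context (R : realType) (n : nat).
Implicit Types (h : 'rV[R]_n -> R) (p : 'rV[R]_n) (a z : 'rV[R]_n.+1).

Definition selection h a : 'rV[R]_n.+1 := steiner (nearby (conj_epi h) a).

Lemma conj_epi_nonempty h : continuous h ->
  convex_function [set: 'rV[R]_n] h -> conj_epi h !=set0.
Proof.
move=> hc hv; have [|z hz _] := @fenchel_moreau R n h 0 (h 0 - 1) hc hv.
  by lra.
by exists z.
Qed.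

Lemma selection_nearby h a : continuous h ->
  convex_function [set: 'rV[R]_n] h ->
  nearby (conj_epi h) a (selection h a).
Proof.
move=> hc hv; have h0 := conj_epi_nonempty hc hv.
apply: steiner_mem.
- by apply: nearby_compact => //; exact: conj_epi_closed.
- by apply: nearby_nonempty => //; exact: conj_epi_closed.
- by apply: nearby_convex; exact: conj_epi_convex.
Qed.

Lemma selection_mem h a : continuous h ->
  convex_function [set: 'rV[R]_n] h -> conj_epi h (selection h a).
Proof. by move=> hc hv; have [] := selection_nearby a hc hv. Qed.

Lemma selection_id h a : continuous h ->
  convex_function [set: 'rV[R]_n] h -> conj_epi h a -> selection h a = a.
Proof. by move=> hc hv ha; apply: nearby_mem ha _; exact: selection_nearby. Qed.

(** The closeness of the epigraphs is required on the truncations only, where it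
    can also be proved by compactness. *)
Lemma selection_lipschitz h1 h2 a b (D : R) :
  continuous h1 -> convex_function [set: 'rV[R]_n] h1 ->
  continuous h2 -> convex_function [set: 'rV[R]_n] h2 -> 0 <= D ->
  (forall x, nearby (conj_epi h1) a x ->
    exists2 z, conj_epi h2 z & enorm (x - z) <= D) ->
  (forall x, nearby (conj_epi h2) b x ->
    exists2 z, conj_epi h1 z & enorm (x - z) <= D) ->
  enorm (selection h1 a - selection h2 b) <=
    10 * n.+1%:R * (D + enorm (a - b)).
Proof.
move=> c1 v1 c2 v2 D0 D12 D21.
have N1 := conj_epi_nonempty c1 v1; have N2 := conj_epi_nonempty c2 v2.
have C1 := @conj_epi_closed R n h1; have C2 := @conj_epi_closed R n h2.
have V1 := @conj_epi_convex R n h1; have V2 := @conj_epi_convex R n h2.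
rewrite (mulrC 10) -mulrA; apply: steiner_lipschitz.
- by rewrite mulr_ge0// addr_ge0// enorm_ge0.
- exact: nearby_compact.
- exact: nearby_nonempty.
- exact: nearby_convex.
- exact: nearby_compact.
- exact: nearby_nonempty.
- exact: nearby_convex.
- exact: nearby_lipschitz.
- by rewrite enormB; exact: nearby_lipschitz.
Qed.

End Parametrization.

Section PointwiseConvergence.
Context (R : realType) (n : nat).
Implicit Types (p c : 'rV[R]_n) (z : 'rV[R]_n.+1).

Definition ratvec (q : 'rV[rat]_n) : 'rV[R]_n := map_mx ratr q.

Lemma ratvec_dense p (U : set 'rV[R]_n) : nbhs p U -> exists q, U (ratvec q).
Proof.
move=> /nbhs_ballP[e /= e0 eU].
have /choice[q qP] : forall i, exists q : rat, `|p 0 i - ratr q| < e.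
  move=> i; have [|q] := @rat_in_itvoo R (p 0 i - e) (p 0 i + e).
    by rewrite ltrD2l gtrN.
  rewrite in_itv /= => /andP[? ?]; exists q.
  by rewrite ltr_distlC; apply/andP; split; lra.
exists (\row_i q i); apply: eU; split => // i j.
by rewrite !mxE ord1; exact: qP.
Qed.

Context (I : Type) (F : set_system I) (FF : Filter F).
Context (h : I -> 'rV[R]_n -> R) (h0 : 'rV[R]_n -> R).
Context (h_conv : \forall i \near F, convex_function [set: 'rV[R]_n] (h i)).
Context (h_cont : \forall i \near F, continuous (h i)).
Context (h0_conv : convex_function [set: 'rV[R]_n] h0).
Context (h0_cont : continuous h0).
Context (h_cvg : forall q, h i (ratvec q) @[i --> F] --> h0 (ratvec q)).

(** A ball lies in a cross-polytope with rational vertices, and a convex function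
    is bounded on it by its values at the finitely many vertices. *)
Lemma near_upper_bound (M : R) : exists2 C, 0 <= C &
  \forall i \near F, forall c, enorm c <= M -> h i c <= C.
Proof.
pose L := (Num.truncn (n.+1%:R * `|M|)).+1.
pose e (s : bool) (j : 'I_n) : 'rV[rat]_n := ((-1) ^+ s * L%:R) *: delta_mx 0 j.
pose C : R := \sum_(s : bool) \sum_j `|h0 (ratvec (e s j))| + `|h0 (ratvec 0)| + 1.
have eC s j : h0 (ratvec (e s j)) < C.
  rewrite /C (bigD1 s)//= (bigD1 j)//= (le_lt_trans (ler_norm _))//.
  rewrite -!addrA ltrDl !ltr_wpDl// ?sumr_ge0// => k _.
  by rewrite sumr_ge0.
have zC : h0 (ratvec 0) < C.
  rewrite /C (le_lt_trans (ler_norm _))// ltr_pwDr// lerDr.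
  by apply: sumr_ge0 => s _; apply: sumr_ge0.
have C0 : 0 <= C.
  by rewrite /C !addr_ge0// sumr_ge0// => s _; apply: sumr_ge0.
exists C => //.
have ratv0 : ratvec 0 = 0 by apply/rowP => j; rewrite !mxE rmorph0.
have ratve s j : ratvec (e s j) = ((-1) ^+ s * L%:R) *: delta_mx 0 j.
  by apply/rowP => k; rewrite !mxE !rmorphM rmorphXn rmorphN1 /= !ratr_nat.
have near_e : \forall i \near F, forall s j, h i (ratvec (e s j)) <= C.
  apply: (@filter_forall _ _ (fun s i => forall j, h i (ratvec (e s j)) <= C) F FF).
  move=> s; apply: (@filter_forall _ _ (fun j i => h i (ratvec (e s j)) <= C) F FF).
  move=> j; apply: (@filterS _ F FF (fun i => h i (ratvec (e s j)) < C)) => [i /ltW//|].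
  exact: (cvgr_lt _ (@h_cvg (e s j)) _ (eC s j)).
near=> i.
have he : forall s j, h i (ratvec (e s j)) <= C by near: i.
have /convex_functionP hv : convex_function [set: 'rV[R]_n] (h i) by near: i.
have hz : h i 0 <= C.
  rewrite -ratv0; apply: ltW; near: i; exact: (cvgr_lt _ (@h_cvg 0) _ zC).
have L0 : 0 < L%:R :> R by rewrite ltr0n.
have sub : convex_set [set c | h i c <= C].
  apply/convex_setP => x y s /= xC yC s0 s1; rewrite (le_trans (hv _ _ _ s0 s1))//.
  have s1' : 0 <= 1 - s by rewrite subr_ge0.
  have := ler_wpM2l s0 xC; have := ler_wpM2l s1' yC; lra.
move=> c cM.
(* [c] is the mean of [n + 1] points, the origin and one on each axis *)
pose X (k : 'I_n.+1) : 'rV[R]_n :=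
  if unlift ord0 k is Some j then (n.+1%:R * c 0 j) *: delta_mx 0 j else 0.
have -> : c = #|'I_n.+1|%:R^-1 *: \sum_k X k.
  rewrite card_ord; apply: (canRL (scalerK _)); first by rewrite pnatr_eq0.
  rewrite big_ord_recl {1}/X unlift_none add0r [in LHS](row_sum_delta c) scaler_sumr.
  by apply: eq_bigr => j _; rewrite /X liftK scalerA.
apply: (convex_set_mean _ sub) => [|k]; first by rewrite card_ord.
rewrite /= /X; case: unliftP => [j _|_]; last exact: hz.
set t := _ * _.
have tL : `|t| <= L%:R.
  rewrite /t normrM ger0_norm// (@le_trans _ _ (n.+1%:R * `|M|))//.
    rewrite ler_wpM2l// (le_trans (coord_enorm c j))// (le_trans cM)//.
    exact: ler_norm.
  exact/ltW/truncnS_gt.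
have := tL; rewrite ler_norml => /andP[Lt tL'].
have -> : t *: delta_mx 0 j = ((1 + t / L%:R) / 2) *: ratvec (e false j) +
    (1 - (1 + t / L%:R) / 2) *: ratvec (e true j).
  rewrite !ratve !scalerA -scalerDl expr0 expr1; congr (_ *: _).
  by field; rewrite gt_eqF.
have t1 : t / L%:R <= 1 by rewrite ler_pdivrMr// mul1r.
have t2 : - 1 <= t / L%:R by rewrite ler_pdivlMr// mulN1r.
move/convex_setP : sub; apply; rewrite /= ?he//; lra.
Unshelve. all: by end_near. Qed.

(** A convex function bounded above near a point cannot drop far below its value
    at a nearby rational point [g]: extrapolating the segment from [c] through
    [g] gives a point [c'] where it would exceed the bound.  Compactness of the
    ball makes the estimate uniform. *)
Lemma near_lower_bound (M gamma : R) : 0 < gamma ->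
  \forall i \near F, forall c, enorm c <= M -> h0 c - gamma <= h i c.
Proof.
move=> g0; have [C C0 hC] := near_upper_bound (M + 2).
suff H : \forall i \near F, [set c | enorm (c - 0) <= M] `<=`
    [set c | h0 c - gamma <= h i c].
  by apply: filterS H => i H c cM; apply: H; rewrite /= subr0.
have /compact_near_coveringP := @compact_enorm_le R n 0 M.
apply => p; rewrite /= subr0 => pM.
pose B := C + `|h0 p| + gamma.
have B0 : 0 < B by rewrite ltr_wpDl// addr_ge0.
(* the extrapolation factor: the slope [K * gamma] beats all bounded terms *)
pose K := 1 + 8 * B / gamma.
have K1 : 1 <= K by rewrite lerDl divr_ge0 ?mulr_ge0// ltW.
have KB : K * gamma = gamma + 8 * B by rewrite /K; field; rewrite gt_eqF.
have K0 : 0 < K by lra.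
have tau0 : 0 < (2 * K)^-1 by rewrite invr_gt0 mulr_gt0.
have near_p : \forall c \near p, enorm (c - p) < (2 * K)^-1 /\ `|h0 c - h0 p| < gamma / 8.
  apply: filterI; first exact: enorm_near.
  have /cvgrPdistC_lt := h0_cont (x := p); apply; lra.
have [g [gp hg]] := ratvec_dense near_p.
near=> c i.
have [cp hcp] : enorm (c - p) < (2 * K)^-1 /\ `|h0 c - h0 p| < gamma / 8 by near: c.
have hi : forall c, enorm c <= M + 2 -> h i c <= C by near: i.
have /convex_functionP hv : convex_function [set: 'rV[R]_n] (h i) by near: i.
have hig : h0 (ratvec g) - gamma / 8 < h i (ratvec g).
  near: i; apply: (cvgr_gt _ (@h_cvg g)); lra.
pose c' := ratvec g + K *: (ratvec g - c).
have tauK : K * (2 * K)^-1 = 1 / 2 by field; rewrite gt_eqF.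
have tau1 : (2 * K)^-1 <= 1 / 2 by rewrite -tauK ler_peMl// ltW.
have c'M : enorm c' <= M + 2.
  have := enormD (ratvec g) (K *: (ratvec g - c)).
  have := enorm_triangle p (ratvec g) c; rewrite enormZ gtr0_norm// (enormB p c).
  have := enorm_leB (ratvec g) p; rewrite -/c' => h1 h2 h3.
  have /(ler_wpM2l (ltW K0)) h4 : enorm (ratvec g - c) <= (2 * K)^-1 + (2 * K)^-1.
    by lra.
  by rewrite mulrDr tauK in h4; lra.
have K10 : 0 < K + 1 by lra.
have s0 : 0 <= K / (K + 1) by rewrite divr_ge0// ltW.
have s1 : K / (K + 1) <= 1 by rewrite ler_pdivrMr// mul1r; lra.
have := hv c c' (K / (K + 1)) s0 s1.
have -> : K / (K + 1) *: c + (1 - K / (K + 1)) *: c' = ratvec g.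
  by apply/rowP => j; rewrite /c' !mxE; field; rewrite gt_eqF.
rewrite -(ler_pM2l K10).
have -> : (K + 1) * (K / (K + 1) * h i c + (1 - K / (K + 1)) * h i c') =
    K * h i c + h i c'.
  by field; rewrite gt_eqF.
have hc' := hi c' c'M; move=> hgc; rewrite leNgt; apply/negP => hic.
have {hic} : K * h i c < K * (h0 c - gamma) by rewrite ltr_pM2l.
move: (hcp) (hg); rewrite !ltr_norml => /andP[_ hcp'] /andP[hg' _].
have : K * (h0 c - gamma) <= K * (h0 p - 7 / 8 * gamma).
  by rewrite ler_pM2l//; lra.
have : (K + 1) * (h0 p - gamma / 4) <= (K + 1) * h i (ratvec g).
  by rewrite ler_pM2l//; lra.
have BE : B = C + `|h0 p| + gamma by [].
have := ler_norm (- h0 p); rewrite normrN.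
lra.
Unshelve. all: by end_near. Qed.

(** Far from the origin the required bound follows by convexity along the
    segment from [0], since it is weakened by [d * |p|] there. *)
Lemma near_conj_epi_lower (M d : R) : 0 < d ->
  \forall i \near F, forall z, conj_epi h0 z -> enorm z <= M ->
    exists2 y, conj_epi (h i) y & enorm (z - y) <= d.
Proof.
move=> d0; pose C := `|h0 0| + 1 + `|M|.
have C0 : 0 < C by rewrite /C; have := normr_ge0 (h0 0); have := normr_ge0 M; lra.
(* beyond this radius [d * |p|] absorbs the values at the origin *)
pose r := (C + d) / d; have r0 : 0 < r by rewrite divr_gt0// addr_gt0.
have rd : r * d = C + d by rewrite /r divfK ?gt_eqF.
have d2 : 0 < d / 2 by rewrite divr_gt0.
have low := near_lower_bound r d2.
have h00 : \forall i \near F, h i 0 < h0 0 + 1.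
  have -> : 0 = ratvec 0 by apply/rowP => j; rewrite !mxE rmorph0.
  by apply: (cvgr_lt _ (@h_cvg 0)); rewrite ltrDl.
near=> i => z hz zM.
have hi0 : h i 0 < h0 0 + 1 by near: i.
have lowi : forall c, enorm c <= r -> h0 c - d / 2 <= h i c by near: i.
have hv : convex_function [set: 'rV[R]_n] (h i) by near: i.
apply: conj_epi_near => //; [by near: i|exact: ltW|move=> p].
have zM' : height z <= `|M|.
  rewrite (le_trans _ (ler_norm M))// (le_trans _ zM)//.
  by rewrite (le_trans _ (height_le z))// ler_norm.
have [pr|rp] := leP (enorm p) r.
  have := hz p; have := lowi p pr; have := ler_wpM2l (ltW d0) (ge1_enorm_pack p).
  by lra.
have p0 : 0 < enorm p by exact: lt_trans rp.
pose s := r / enorm p.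
have s0 : 0 < s by rewrite divr_gt0.
have s1 : s <= 1 by rewrite ler_pdivrMr// mul1r ltW.
have sp : s * enorm p = r by rewrite /s divfK ?gt_eqF.
move/(iffLR (convex_functionP _))/(_ p 0 s (ltW s0) s1) : (hv).
rewrite scaler0 addr0 => hsp.
have := hz (s *: p); rewrite dotZl => hzp.
have := lowi (s *: p); rewrite enormZ gtr0_norm// sp lexx => /(_ isT) lowp.
have hC : h i 0 + height z <= C by have := ler_norm (h0 0); rewrite /C; lra.
have s1' : 0 <= 1 - s by rewrite subr_ge0.
have := ler_wpM2l s1' hC => hC'.
have sC : 0 <= s * C by rewrite mulr_ge0 ?ltW.
have := ler_wpM2l (ltW d0) (le_enorm_pack p 1) => dp.
rewrite -(ler_pM2l s0) mulrBr mulrDr.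
have := ler_wpM2l (ltW s0) dp; rewrite (mulrCA s) sp (mulrC d) rd.
by lra.
Unshelve. all: by end_near. Qed.

(** A point outside the closed set [conj_epi h0] violates one of its constraints
    at a rational point, hence so do the points around it for [h i]. *)
Lemma near_conj_epi_upper (M d : R) : 0 < d ->
  \forall i \near F, forall z, conj_epi (h i) z -> enorm z <= M ->
    exists2 y, conj_epi h0 y & enorm (z - y) <= d.
Proof.
move=> d0.
suff H : \forall i \near F, [set z | enorm (z - 0) <= M] `<=` [set z |
    conj_epi (h i) z -> exists2 y, conj_epi h0 y & enorm (z - y) <= d].
  by apply: filterS H => i H z hz zM; apply: H => //; rewrite /= subr0.
have /compact_near_coveringP := @compact_enorm_le R n.+1 0 M.
apply => z _; have [hz|] := pselect (conj_epi h0 z).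
  near=> z' i.
  have z'z : enorm (z' - z) < d by near: z'; exact: enorm_near.
  by move=> _; exists z => //; exact: ltW.
move=> /existsNP[p /negP]; rewrite -ltNge => hp.
have hc : continuous (fun p => dot p (slope z) - height z - h0 p).
  move=> q; apply: (@cvgB _ _ _ (nbhs q) _ (fun p => dot p (slope z) - height z) h0);
    last exact: h0_cont.
  apply: (@cvgB _ _ _ (nbhs q) _ (fun p => dot p (slope z)) (cst (height z)));
    last exact: cvg_cst.
  under eq_fun do rewrite dotC; rewrite dotC; exact: dot_continuous.
have /ratvec_dense[q] : \forall q \near p, 0 < dot q (slope z) - height z - h0 q.
  by apply: (cvgr_gt _ (hc p)); rewrite subr_gt0.
rewrite subr_gt0 => hq.
pose mid := (h0 (ratvec q) + (dot (ratvec q) (slope z) - height z)) / 2.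
near=> z' i.
have hi : h i (ratvec q) < mid.
  by near: i; apply: (cvgr_lt _ (@h_cvg q)); rewrite /mid; lra.
have zi : mid < dot (pack (- 1) (ratvec q)) z'.
  near: z'; apply: (cvgr_gt _ (@dot_continuous _ _ (pack (- 1) (ratvec q)) z)).
  by rewrite dot_pack /mid; lra.
by move=> /(_ (ratvec q)); rewrite -dot_pack leNgt (lt_trans hi zi).
Unshelve. all: by end_near. Qed.

(** The truncation at [a0] controls the distance from [a i] to the set of [h i],
    hence bounds the truncations at [a i]: both sets need only be compared on
    bounded regions. *)
Lemma selection_cvg (a : I -> 'rV[R]_n.+1) a0 : a i @[i --> F] --> a0 ->
  selection (h i) (a i) @[i --> F] --> selection h0 a0.
Proof.
move=> aa0; apply/enorm_cvgP => e e0.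
have [z0 hz0 _] := nearest_point a0 (@conj_epi_closed R n h0)
  (conj_epi_nonempty h0_cont h0_conv).
pose r0 := enorm (z0 - a0).
pose m : R := 10 * n.+1%:R.
have m0 : 0 < m by rewrite mulr_gt0.
pose d := Num.min 1 (e / (4 * m)).
have d0 : 0 < d by rewrite lt_min ltr01 divr_gt0// mulr_gt0.
have dm : m * (4 * d) <= e.
  have : d <= e / (4 * m) by rewrite ge_min lexx orbT.
  by rewrite ler_pdivlMr ?mulr_gt0//; lra.
have d1 : d <= 1 by rewrite ge_min lexx.
have low := near_conj_epi_lower (2 * r0 + enorm a0) d0.
have up := near_conj_epi_upper (2 * (r0 + 2) + enorm a0 + 1) d0.
have aa : \forall i \near F, enorm (a i - a0) < d.
  by move/enorm_cvgP : aa0; apply.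
near=> i.
have ai : enorm (a i - a0) < d by near: i.
have lowi : forall z, conj_epi h0 z -> enorm z <= 2 * r0 + enorm a0 ->
  exists2 y, conj_epi (h i) y & enorm (z - y) <= d by near: i.
have upi : forall z, conj_epi (h i) z -> enorm z <= 2 * (r0 + 2) + enorm a0 + 1 ->
  exists2 y, conj_epi h0 y & enorm (z - y) <= d by near: i.
have r00 : 0 <= r0 by exact: enorm_ge0.
have [y0 hy0 zy0] : exists2 y, conj_epi (h i) y & enorm (z0 - y) <= d.
  by apply: lowi => //; have := enorm_leB z0 a0; rewrite -/r0; lra.
apply: (@lt_le_trans _ _ (m * (4 * d))) => //.
apply: (@le_lt_trans _ _ (m * (d + enorm (a i - a0)))); last first.
  by rewrite ltr_pM2l//; lra.
apply: selection_lipschitz => //; [by near: i|by near: i|exact: ltW|move=> x|move=> x].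
  move=> [hx /(_ y0 hy0) xa]; apply: upi => //.
  have := enorm_leB x (a i); have := enorm_leB (a i) a0.
  have := enorm_triangle z0 y0 (a i); have := enorm_triangle a0 z0 (a i).
  by rewrite (enormB y0 z0) (enormB a0 (a i)) -/r0; lra.
move=> [hx /(_ z0 hz0) xa]; apply: lowi => //.
by have := enorm_leB x a0; rewrite -/r0 in xa *; lra.
Unshelve. all: by end_near. Qed.

End PointwiseConvergence.
(** * Measurability through countably many coordinates *)

Section CountablyManyCoordinates.
Context (R : realType) (d : measure_display) (T : measurableType d).
Context (J : countType) (D : set T) (g : J -> T -> R).
Context (mg : forall j, measurable_fun D (g j)).

(** The rational boxes are a countable base for the coarsest topology on [D]
    making all the [g j] continuous. *)
Definition coordinate_box (s : seq (J * (rat * rat))) : set T :=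
  [set t | D t /\ forall x, x \in s -> ratr x.2.1 < g x.1 t < ratr x.2.2].

Lemma measurable_coordinate_box s : measurable D -> measurable (coordinate_box s).
Proof.
move=> mD; elim: s => [|x s IH].
  by have -> : coordinate_box [::] = D by apply/seteqP; split=> t // [].
have -> : coordinate_box (x :: s) =
    D `&` g x.1 @^-1` `]ratr x.2.1, ratr x.2.2[ `&` coordinate_box s.
  apply/seteqP; split=> t.
    move=> [Dt xs]; split; last first.
      by split=> // y ys; apply: xs; rewrite inE ys orbT.
    by split=> //=; rewrite in_itv /=; apply: xs; rewrite mem_head.
  move=> [[Dt]]; rewrite /= in_itv /= => xt [_ ys]; split=> // y.
  by rewrite inE => /orP[/eqP->//|]; exact: ys.
by apply: measurableI => //; apply: mg.
Qed.

Definition coordinate_filter (t0 : T) : set_system T :=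
  filter_from [set s | coordinate_box s t0] coordinate_box.

Lemma coordinate_filter_filter t0 : D t0 -> Filter (coordinate_filter t0).
Proof.
move=> Dt0; apply: filter_from_filter; first by exists [::].
move=> s1 s2 [_ h1] [_ h2]; exists (s1 ++ s2) => [|t [Dt h]].
  by split=> // x; rewrite mem_cat => /orP[/h1|/h2].
by split; split=> // x xs; apply: h; rewrite mem_cat xs ?orbT.
Qed.

Lemma coordinate_filter_cvg t0 j : D t0 ->
  g j t @[t --> coordinate_filter t0] --> g j t0.
Proof.
move=> Dt0; have FF := coordinate_filter_filter Dt0.
apply/cvgrPdist_lt => e e0.
have [|q1] := @rat_in_itvoo R (g j t0 - e) (g j t0); first by rewrite ltrBlDr ltrDl.
have [|q2] := @rat_in_itvoo R (g j t0) (g j t0 + e); first by rewrite ltrDl.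
rewrite !in_itv /= => /andP[q2a q2b] /andP[q1a q1b].
exists [:: (j, (q1, q2))].
  by split=> // x; rewrite inE => /eqP->/=; rewrite q1b q2a.
move=> t [Dt /(_ _ (mem_head _ _)) /= /andP[h1 h2]] /=.
by rewrite ltr_distlC; apply/andP; split; lra.
Qed.

(** A function that is continuous whenever all the [g j] are, is continuous for
    the topology they generate, so the inverse image of an open set is the union
    of the countably many rational boxes it contains. *)
Lemma measurable_preimage_open (V : topologicalType) (G : T -> V) (U : set V) :
  (forall t0 (F : set_system T), D t0 -> Filter F -> F D ->
    (forall j, g j t @[t --> F] --> g j t0) -> G @ F --> G t0) ->
  measurable D -> open U -> measurable (D `&` G @^-1` U).
Proof.
move=> Gcvg mD oU.
have -> : D `&` G @^-1` U = \bigcup_s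
    (if `[< coordinate_box s `<=` G @^-1` U >] then coordinate_box s else set0).
  apply/seteqP; split=> [t0 [Dt0 Ut0]|t [s _]].
    have FF := coordinate_filter_filter Dt0.
    have FD : coordinate_filter t0 D by exists [::] => // t [].
    have : (G @ coordinate_filter t0) U.
      apply: (Gcvg t0 _ Dt0 FF FD) => [j|]; first exact: coordinate_filter_cvg.
      exact: open_nbhs_nbhs.
    by move=> [s st0 sU]; exists s => //; case: asboolP.
  by case: asboolP => // sU st; split; [case: st|exact: sU].
apply: countable_bigcupT_measurable; first exact: countableP.
by move=> s; case: asboolP => // _; exact: measurable_coordinate_box.
Qed.

End CountablyManyCoordinates.
(** * The representation theorem *)

Lemma edom_fconjP (R : realType) (n : nat) (h : 'rV[R]_n -> R) v :
  edom (fconj h) v <-> exists2 z, conj_epi h z & slope z = v.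
Proof.
have ge0 : ((- h 0)%:E <= fconj h v)%E.
  by apply: ereal_sup_ubound; exists 0 => //; rewrite dot0r sub0r.
split=> [vfin|[z hz vE]]; last move: vE ge0 => <- ge0.
  exists (pack (fine (fconj h v)) v); last exact: slope_pack.
  move=> p; rewrite slope_pack height_pack lerBlDr -lerBlDl -lee_fin fineK//.
  by apply: ereal_sup_ubound; exists p => //; rewrite dotC.
rewrite /edom /= fin_numElt; apply/andP; split.
  by rewrite (lt_le_trans _ ge0)// ltNyr.
apply: (@le_lt_trans _ _ (height z)%:E); last exact: ltry.
apply: ge_ereal_sup => _ [p _ <-]; rewrite lee_fin dotC.
by have := hz p; lra.
Qed.

(** Along the direction of the slope itself, the affine minorant given by [z] would
    outgrow [h]. *)
Lemma conj_epi_slope_bound (R : realType) (n : nat) (h : 'rV[R]_n -> R) (C : R) z :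
  0 <= C -> (forall p q, `|h p - h q| <= C * enorm (p - q)) ->
  conj_epi h z -> enorm (slope z) <= C.
Proof.
move=> C0 hC hz; rewrite leNgt; apply/negP => Cz.
set e := enorm (slope z) in Cz.
have e0 : 0 < e by exact: le_lt_trans Cz.
have main s : 0 < s -> s * (e ^+ 2 - C * e) <= height z + h 0.
  move=> s0; have := hz (s *: slope z); rewrite dotZl -enorm_sqr -/e.
  have := le_trans (ler_norm _) (hC (s *: slope z) 0).
  by rewrite subr0 enormZ gtr0_norm// -/e; lra.
have X0 : 0 < e ^+ 2 - C * e by rewrite expr2 -mulrBl mulr_gt0// subr_gt0.
pose K := `|height z + h 0| + 1.
have K0 : 0 < K by rewrite ltr_wpDl.
have := main (K / (e ^+ 2 - C * e)) (divr_gt0 K0 X0).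
rewrite divfK ?gt_eqF// /K; have := ler_norm (height z + h 0); lra.
Qed.

Lemma fenchel_sup (R : realType) (n : nat) (h : 'rV[R]_n -> R) (A : Type)
    (e : A -> 'rV[R]_n.+1) p :
  continuous h -> convex_function [set: 'rV[R]_n] h -> range e = conj_epi h ->
  (h p)%:E = ereal_sup (range (fun a => (dot p (slope (e a)) - height (e a))%:E)).
Proof.
move=> hc hv eE; have eh a : conj_epi h (e a) by rewrite -eE; exists a.
apply/eqP; rewrite eq_le; apply/andP; split; last first.
  by apply: ge_ereal_sup => _ [a _ <-]; rewrite lee_fin; exact: eh.
apply/lee_addgt0Pr => eps eps0.
have [|z hz pz] := @fenchel_moreau R n h p (h p - eps) hc hv; first by lra.
have [a _ ea] : range e z by rewrite eE.
rewrite -leeBlDr// (le_trans (y := (dot p (slope z) - height z)%:E))//.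
by apply: ereal_sup_ubound; exists a => //; rewrite ea.
Qed.

Lemma range_selection (R : realType) (n : nat) (h : 'rV[R]_n -> R) :
  continuous h -> convex_function [set: 'rV[R]_n] h ->
  range (selection h) = conj_epi h.
Proof.
move=> hc hv; apply/seteqP; split=> [_ [a _ <-]|z hz]; first exact: selection_mem.
by exists z => //; exact: selection_id.
Qed.

Lemma measurable_open_fun (R : realType) (D : set R) (n : nat)
    (f : R -> 'rV[R]_n) (T := caratheodory_type ((@wlength R idfun)^*)%mu) :
  (forall U : set 'rV[R]_n, open U -> measurable (D : set T) ->
     measurable (D `&` f @^-1` U : set T)) ->
  lebesgue_measurable_fun D (f : R -> borel_rV R n).
Proof.
move=> fU mD; move: (mD).
apply: (@measurability _ _ T (borel_rV R n) D f (@open 'rV[R]_n)) => //.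
by move=> _ [U oU <-]; exact: fU.
Qed.

Lemma measurable_open_funR (R : realType) (D : set R) (f : R -> R)
    (T := caratheodory_type ((@wlength R idfun)^*)%mu) :
  (forall U : set R, open U -> measurable (D : set T) ->
     measurable (D `&` f @^-1` U : set T)) ->
  lebesgue_measurable_fun D f.
Proof.
move=> fU mD; move: (mD).
apply: (@measurability _ _ T R D f _ (measurable_realfun.RGenOpens.measurableE R)).
by move=> _ [_ [a [b ->]] <-]; apply: fU => //; exact: interval_open.
Qed.

Lemma cvg_to_pair (T : Type) (U V : topologicalType) (F : set_system T)
    (f : T -> U) (g : T -> V) (a : U) (b : V) : Filter F ->
  f @ F --> a -> g @ F --> b -> (fun x => (f x, g x)) @ F --> (a, b).
Proof.
move=> FF fa gb.
exact: (@cvg_pair _ _ _ F (nbhs a) (nbhs b) FF _ _ f g fa gb).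
Qed.

Theorem theorem3p1 (R : realType) (n : nat) (T : R) (hT : 0 <= T)
  (H : R -> 'rV[R]_n -> 'rV[R]_n -> R)
  (H_meas : forall x p : 'rV[R]_n,
    lebesgue_measurable_fun `[0, T] (fun t => H t x p))
  (H_cont : forall t, t \in `[0, T] ->
    continuous (fun z : 'rV[R]_n * 'rV[R]_n => H t z.1 z.2))
  (H_convex : forall t, t \in `[0, T] -> forall x : 'rV[R]_n,
    convex_function [set: 'rV[R]_n] (H t x))
  (k : R -> R -> R) (w : R -> R -> R -> R) (N : R -> set R)
  (k_meas : forall r, 0 < r -> lebesgue_measurable_fun `[0, T] (k r))
  (k_ge0 : forall r, 0 < r -> forall t, t \in `[0, T] -> 0 <= k r t)
  (w_modulus : forall r, 0 < r -> is_modulus T (w r))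
  (N_sub : forall r, 0 < r -> N r `<=` `[0, T])
  (N_null : forall r, 0 < r -> (@lebesgue_measure R).-negligible (N r))
  (H_lip : forall r, 0 < r -> forall t, t \in `[0, T] -> ~ N r t ->
    forall x y p : 'rV[R]_n, cball r x -> cball r y ->
    `|H t x p - H t y p| <=
      k r t * enorm p * enorm (x - y) + w r t (enorm (x - y))) :
  exists (f : R -> 'rV[R]_n -> 'rV[R]_n.+1 -> 'rV[R]_n)
         (l : R -> 'rV[R]_n -> 'rV[R]_n.+1 -> R),
    (forall (x : 'rV[R]_n) (a : 'rV[R]_n.+1),
      lebesgue_measurable_fun `[0, T] (fun t => f t x a : borel_rV R n) /\
      lebesgue_measurable_fun `[0, T] (fun t => l t x a)) /\
    (forall t, t \in `[0, T] ->
      continuous (fun z : 'rV[R]_n * 'rV[R]_n.+1 => f t z.1 z.2) /\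
      continuous (fun z : 'rV[R]_n * 'rV[R]_n.+1 => l t z.1 z.2)) /\
    (forall t, t \in `[0, T] -> forall x p : 'rV[R]_n,
      (H t x p)%:E =
        ereal_sup (range (fun a : 'rV[R]_n.+1 =>
          (dot p (f t x a) - l t x a)%:E))) /\
    (forall t, t \in `[0, T] -> forall x : 'rV[R]_n,
      range (f t x) = edom (fconj (H t x))) /\
    (forall t, t \in `[0, T] -> forall (x : 'rV[R]_n) (a : 'rV[R]_n.+1),
      - `|H t x 0| <= l t x a) /\
    (forall r, 0 < r -> forall t, t \in `[0, T] -> ~ N r t ->
      forall (x y : 'rV[R]_n) (a b : 'rV[R]_n.+1), cball r x -> cball r y ->
      enorm (f t x a - f t y b) <= 10 * n.+1%:R *
        (k r t * enorm (x - y) + w r t (enorm (x - y)) + enorm (a - b)) /\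
      `|l t x a - l t y b| <= 10 * n.+1%:R *
        (k r t * enorm (x - y) + w r t (enorm (x - y)) + enorm (a - b))) /\
    (forall c : R -> R,
      lebesgue_measurable_fun `[0, T] c ->
      (forall t, t \in `[0, T] -> 0 <= c t) ->
      (forall t, t \in `[0, T] -> forall x p q : 'rV[R]_n,
        `|H t x p - H t x q| <= c t * (1 + enorm x) * enorm (p - q)) ->
      forall t, t \in `[0, T] -> forall (x : 'rV[R]_n) (a : 'rV[R]_n.+1),
        enorm (f t x a) <= c t * (1 + enorm x)) /\
    ({within [set z : R * 'rV[R]_n * 'rV[R]_n | z.1.1 \in `[0, T]],
        continuous (fun z => H z.1.1 z.1.2 z.2)} ->
     {within [set z : R * 'rV[R]_n * 'rV[R]_n.+1 | z.1.1 \in `[0, T]],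
        continuous (fun z => f z.1.1 z.1.2 z.2)} /\
     {within [set z : R * 'rV[R]_n * 'rV[R]_n.+1 | z.1.1 \in `[0, T]],
        continuous (fun z => l z.1.1 z.1.2 z.2)}).
Proof.
have Hc t : t \in `[0, T] -> forall x, continuous (H t x).
  move=> tT x p; apply: (@continuous_comp _ _ _ (fun p => (x, p))
    (fun z : 'rV[R]_n * 'rV[R]_n => H t z.1 z.2) p); last exact: H_cont.
  apply: (@cvg_to_pair _ _ _ (nbhs p) (cst x) id x p _); [exact: cvg_cst|exact: cvg_id].
have Hv := H_convex.
pose e t x a := selection (H t x) a.
have e_epi t x a : t \in `[0, T] -> conj_epi (H t x) (e t x a).
  by move=> tT; apply: selection_mem; [exact: Hc|exact: Hv].
have e_range t x : t \in `[0, T] -> range (e t x) = conj_epi (H t x).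
  by move=> tT; apply: range_selection; [exact: Hc|exact: Hv].
have e_meas x a U : open U ->
    @measurable _ (caratheodory_type ((@wlength R idfun)^*)%mu) `[0, T] ->
    @measurable _ (caratheodory_type ((@wlength R idfun)^*)%mu)
      (`[0, T] `&` (fun t => e t x a) @^-1` U).
  move=> oU mT.
  apply: (measurable_preimage_open (fun q => H_meas x (ratvec R q))) => //.
  move=> t0 F t0T FF FT Hq; apply: selection_cvg.
  - by apply: filterS FT => t tT; exact: Hv.
  - by apply: filterS FT => t tT; exact: Hc.
  - exact: Hv.
  - exact: Hc.
  - exact: Hq.
  - exact: cvg_cst.
exists (fun t x a => slope (e t x a)), (fun t x a => height (e t x a)).
split.
  move=> x a; split.
    apply: measurable_open_fun => U oU mT.
    apply: (e_meas x a (@slope R n @^-1` U)) => //.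
    by apply: open_comp => // z _; exact: slope_continuous.
  apply: measurable_open_funR => U oU mT.
  apply: (e_meas x a (@height R n @^-1` U)) => //.
  by apply: open_comp => // z _; exact: height_continuous.
split.
  move=> t tT.
  have e_cont : continuous (fun z : 'rV[R]_n * 'rV[R]_n.+1 => e t z.1 z.2).
    move=> z; apply: selection_cvg.
    - by apply: nearW => y; exact: Hv.
    - by apply: nearW => y; exact: Hc.
    - exact: Hv.
    - exact: Hc.
    - move=> q; apply: (@continuous_comp _ _ _ 
        (fun z : 'rV[R]_n * 'rV[R]_n.+1 => (z.1, ratvec R q))
        (fun z : 'rV[R]_n * 'rV[R]_n => H t z.1 z.2) z); last exact: H_cont.
      apply: (@cvg_to_pair _ _ _ (nbhs z) fst (cst (ratvec R q)) z.1 (ratvec R q) _);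
        [exact: cvg_fst|exact: cvg_cst].
    - exact: cvg_snd.
  split=> z.
    apply: (@continuous_comp _ _ _ (fun z => e t z.1 z.2) (@slope R n) z).
      exact: e_cont.
    exact: slope_continuous.
  apply: (@continuous_comp _ _ _ (fun z => e t z.1 z.2) (@height R n) z).
    exact: e_cont.
  exact: height_continuous.
split; first by move=> t tT x p; apply: fenchel_sup; [exact: Hc|exact: Hv|exact: e_range].
split.
  move=> t tT x; apply/seteqP; split=> [_ [a _ <-]|v].
    by apply/edom_fconjP; exists (e t x a) => //; exact: e_epi.
  move=> /edom_fconjP[z hz <-].
  by have [a _ <-] : range (e t x) z; [rewrite e_range|exists a].
split.
  move=> t tT x a; have := e_epi t x a tT 0; rewrite dot0l sub0r.
  by have := ler_norm (H t x 0); lra.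
split.
  move=> r r0 t tT tN x y a b xr yr.
  have k0 := k_ge0 r r0 t tT.
  have [_ /(_ t tT) [w0 _ _ _ _]] := w_modulus r r0.
  set D := k r t * enorm (x - y) + w r t (enorm (x - y)).
  have D0 : 0 <= D by apply: addr_ge0; [exact: mulr_ge0 (enorm_ge0 _)|exact/w0/enorm_ge0].
  have near_epi x' y' : cball r x' -> cball r y' ->
      k r t * enorm (x' - y') + w r t (enorm (x' - y')) = D ->
      forall z, conj_epi (H t x') z ->
      exists2 z', conj_epi (H t y') z' & enorm (z - z') <= D.
    move=> x'r y'r DE z hz; apply: conj_epi_near => //; [exact: Hc|exact: Hv|].
    move=> p; rewrite (le_trans (hz p))//.
    have := le_trans (ler_norm _) (H_lip r r0 t tT tN x' y' p x'r y'r).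
    have := ler_wpM2l (mulr_ge0 k0 (enorm_ge0 (x' - y'))) (le_enorm_pack p 1).
    have := ler_wpM2l (w0 _ (enorm_ge0 (x' - y'))) (ge1_enorm_pack p).
    by rewrite -DE; lra.
  have eL : enorm (e t x a - e t y b) <= 10 * n.+1%:R * (D + enorm (a - b)).
    apply: selection_lipschitz => //; [exact: Hc|exact: Hv|exact: Hc|exact: Hv| |].
      by move=> z [hz _]; exact: near_epi hz.
    by move=> z [hz _]; apply: near_epi hz => //; rewrite (enormB y x).
  split; apply: le_trans eL; first by rewrite -slopeB slope_le.
  by rewrite -heightB height_le.
split.
  move=> c _ c0 cH t tT x a.
  apply: (@conj_epi_slope_bound _ _ (H t x)); [|exact: cH|exact: e_epi].
  by rewrite mulr_ge0 ?c0// addr_ge0 ?enorm_ge0.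
move=> H_joint.
(* along points with [t] in [0, T], [H t x q] converges for every fixed [q] *)
have e_joint (z : R * 'rV[R]_n * 'rV[R]_n.+1) : z.1.1 \in `[0, T] ->
    e y.1.1 y.1.2 y.2 @[y --> within [set y | y.1.1 \in `[0, T]] (nbhs z)] -->
    e z.1.1 z.1.2 z.2.
  move=> zT; apply: selection_cvg.
  - by apply: (@filterE _ (nbhs z)) => y yT; exact: Hv.
  - by apply: (@filterE _ (nbhs z)) => y yT; exact: Hc.
  - exact: Hv.
  - exact: Hc.
  - move=> q W HW.
    have /= hW := iffLR (subspace_continuousP _ _) H_joint (z.1, ratvec R q) zT W HW.
    apply: (@cvg_to_pair _ _ _ (nbhs z) fst (cst (ratvec R q)) z.1
      (ratvec R q) _ _ _ _ hW).
      exact: cvg_fst.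
    exact: cvg_cst.
  - by apply: (@cvg_within_filter _ _ snd (nbhs z)); exact: cvg_snd.
split; apply/subspace_continuousP => z zT.
  exact: (@cvg_comp _ _ _ (fun z => e z.1.1 z.1.2 z.2) (@slope R n) _ _ _
    (e_joint z zT) (@slope_continuous R n _)).
exact: (@cvg_comp _ _ _ (fun z => e z.1.1 z.1.2 z.2) (@height R n) _ _ _
  (e_joint z zT) (@height_continuous R n _)).
Qed.
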